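(* Let $c>0$ and $a_k=c\ln k$ for $k=1,2,\dots$. Then the $\mathbf{a}$-walk is almost surely $C$-recurrent for every $C>0$.
   Context: Let $X_1,X_2,\dots$ be i.i.d. with $P(X_i=1)=P(X_i=-1)=\frac12$. For a non-random sequence $\mathbf{a}=(a_1,a_2,\dots)$, the $\mathbf{a}$-walk is $S(n)=\sum_{k=1}^n a_kX_k$, $S(0)=0$ (here $a_1=0$, all other $a_k$ are positive). For $C\ge 0$, the walk is $C$-recurrent if the event $\{|S(n)|\le C\}$ occurs for infinitely many $n$. *)

(* Defs.v *)
From HB Require Import structures.
From mathcomp Require Import all_boot all_order all_algebra.
From mathcomp Require Import all_classical all_reals all_analysis.

Set Implicit Arguments.
Unset Strict Implicit.
Unset Printing Implicit Defensive.

Import Order.TTheory GRing.Theory Num.Theory.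
Import numFieldNormedType.Exports.

Local Open Scope classical_set_scope.
Local Open Scope ring_scope.

(* Mutual independence of the random variables X i, i \in I: the product rule
   for every finite list J of distinct indices taken from I. *)
Definition mutually_independent (d : measure_display) (T : measurableType d)
    (R : realType) (P : probability T R) (I : set nat)
    (X : nat -> {RV P >-> R}) : Prop :=
  forall (J : seq nat) (B : nat -> set R),
    uniq J -> [set` J] `<=` I -> (forall i, measurable (B i)) ->
    P (\bigcap_(i in [set` J]) (X i @^-1` B i)) =
    (\prod_(i <- J) P (X i @^-1` B i))%E.

(* X 1, X 2, ... are i.i.d. uniform signs; X 0 is unconstrained and unused.
   The two point masses determine the common law, so "identically
   distributed" needs no separate clause. *)
Definition iid_signs (d : measure_display) (T : measurableType d)
    (R : realType) (P : probability T R) (X : nat -> {RV P >-> R}) : Prop :=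
  mutually_independent [set k | (0 < k)%N] X /\
  (forall k, (0 < k)%N ->
     P (X k @^-1` [set 1]) = (2^-1)%:E /\
     P (X k @^-1` [set -1]) = (2^-1)%:E).

Definition walk (d : measure_display) (T : measurableType d)
    (R : realType) (P : probability T R) (a : nat -> R)
    (X : nat -> {RV P >-> R}) (n : nat) (w : T) : R :=
  \sum_(1 <= k < n.+1) a k * X k w.

Definition C_recurrent (R : realType) (C : R) (s : nat -> R) : Prop :=
  infinite_set [set n | `|s n| <= C].

(* Main.v *)
Require Import Defs.
From HB Require Import structures.
From mathcomp Require Import all_boot all_order all_algebra.
From mathcomp Require Import all_classical all_reals all_analysis.
From mathcomp Require Import measurable_realfun ring lra zify.

(** The steps [c * ln k] tend to infinity, but their increments tend to [0] and
    they grow so slowly that the walk keeps coming back near the origin. The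
    proof has two independent halves.

    Coupling. Let two walks, at distance [d] at the same time, use the same signs
    except at a single time [k], where they use opposite signs: their distance
    becomes [d - 2 * a_k] or [d + 2 * a_k]. As the steps increase to infinity
    with small increments, [k] can be chosen with [2 * a_k] very close to [d],
    and repeating this makes the two walks almost equal with probability as
    close to [1] as desired ([coupling]). Hence, if walks started at the origin
    at any late time have a chance at least [q > 0] of visiting [[- C, C]]
    arbitrarily late, then walks started anywhere have a chance at least
    [q / 2] of visiting a slightly larger interval, and a walk that gets
    infinitely many such chances succeeds infinitely often
    ([avoid_vanishes]).

    Counting visits. To find such a [q], compare first moments over a period
    [(N, 8 * N]] with [N = 2 ^ l]; here the steps have order [c * l], so
    the walk spreads over a range of order [sqrt N * l]. On the one hand the
    walk is in [[- C, C]] at a given even time of the period with probability at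
    least of order [1 / (sqrt N * l)]: pairing consecutive steps presents the
    walk as the difference of two almost independent copies of one variable,
    and two copies meet with a probability that is at least the inverse of the
    number of cells that they can occupy ([pair_return]). So the expected number
    of visits is at least of order [sqrt N / l]. On the other hand, after a visit
    the expected number of further visits is at most of the same order, so the
    chance of at least one visit is bounded below ([visits_avoid],
    [log_hit]).

    The upper bound is the delicate point. The Littlewood-Offord bound
    ([littlewood_offord]) only gives a return probability of order
    [1 / sqrt j] after [j] steps, because for a short time the walk remembers its
    position modulo the step. The missing factor [1 / l] appears for [j] at
    least [N / l ^ 2]: two steps at distance [p = N / l ^ 2] with opposite
    signs contribute a difference of order [c / l ^ 2], and there are enough
    such pairs for their sum to spread over a whole step of length about
    [c * l]. The coarse motion and this fine motion are independent, and their
    concentration bounds multiply ([two_scale], [mean_pairs_le],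
    [fine_return]). The first [N / l ^ 2] times contribute only
    [sqrt (N / l ^ 2) = sqrt N / l] by the coarse bound.

    Up to the last part everything is stated for finite averages over signs
    ([mean]); the given random variables enter through [prob_miss], which
    bounds the probability that the walk avoids an interval. *)

Set Implicit Arguments.
Unset Strict Implicit.
Unset Printing Implicit Defensive.

Import Order.TTheory GRing.Theory Num.Theory.
Import numFieldNormedType.Exports.

Local Open Scope classical_set_scope.
Local Open Scope ring_scope.
Local Notation ind b := ((nat_of_bool b%R)%:R).

Lemma ind01 {R : numDomainType} (b : bool) : 0 <= (ind b : R) <= 1.
Proof. by case: b; rewrite ?ler01 ?lexx. Qed.

Lemma ind_le1 {R : numDomainType} (b : bool) : ind b <= 1 :> R.
Proof. by case/andP: (@ind01 R b). Qed.

(** * Averages over independent signs *)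

Section SignMean.
Context {R : realFieldType} {V : zmodType}.
Implicit Types (a b x y z : V) (f g : V -> R) (s : seq V).

Definition step a f x : R := (f (x + a) + f (x - a)) / 2.

(** The expectation of [f (x + S)], where [S] adds up the entries of [s] with
    independent uniform signs. Such averages are commuting operators on
    functions, so they carry all the probability that is needed before the
    very end. The steps live in any abelian group because the joint law of two
    sums, with [V := R * R], is used as well. *)
Definition mean s f : V -> R := foldr step f s.

Lemma ler_step a f g x :
  (forall y, f y <= g y) -> step a f x <= step a g x.
Proof.
by move=> fg; rewrite /step ler_pM2r ?invr_gt0 ?ltr0n// lerD.
Qed.

Lemma ler_mean s f g x :
  (forall y, f y <= g y) -> mean s f x <= mean s g x.
Proof.
move=> fg; elim: s x => [|a s IHs] x /=; first exact: fg.
exact: ler_step.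
Qed.

Lemma mean_cat s1 s2 f : mean (s1 ++ s2) f = mean s1 (mean s2 f).
Proof. exact: foldr_cat. Qed.

Lemma mean_cst s (k : R) x : mean s (fun=> k) x = k.
Proof.
elim: s x => //= a s IHs x; rewrite /step !IHs; lra.
Qed.

Lemma mean_ge0 s f x : (forall y, 0 <= f y) -> 0 <= mean s f x.
Proof. by move=> f0; rewrite -(mean_cst s 0 x); exact: ler_mean. Qed.

Lemma mean_le s f (k : R) x : (forall y, f y <= k) -> mean s f x <= k.
Proof. by move=> fk; rewrite -(mean_cst s k x); exact: ler_mean. Qed.

Lemma meanD s f g x : mean s (fun y => f y + g y) x = mean s f x + mean s g x.
Proof.
elim: s x => //= a s IHs x; rewrite /step !IHs; lra.
Qed.

Lemma meanZ s (k : R) f x : mean s (fun y => k * f y) x = k * mean s f x.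
Proof.
elim: s x => //= a s IHs x; rewrite /step !IHs; lra.
Qed.

Lemma mean_sum (I : Type) (r : seq I) s (F : I -> V -> R) x :
  mean s (fun y => \sum_(i <- r) F i y) x = \sum_(i <- r) mean s (F i) x.
Proof.
elim: r => [|i r IHr].
  by rewrite big_nil -[RHS](mean_cst s 0 x); congr (mean s _ x); apply/funext => y; rewrite big_nil.
rewrite big_cons -IHr -meanD; congr (mean s _ x); apply/funext => y; exact: big_cons.
Qed.

Lemma stepC a b f : step a (step b f) = step b (step a f).
Proof.
apply/funext => x; rewrite /step.
rewrite (addrAC x a b) (addrAC x a (- b)) (addrAC x (- a) b) (addrAC x (- a) (- b)).
lra.
Qed.

Lemma step_mean a s f : step a (mean s f) = mean s (step a f).
Proof. by elim: s => //= b s IHs; rewrite stepC IHs. Qed.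

Lemma meanC s1 s2 f : mean s1 (mean s2 f) = mean s2 (mean s1 f).
Proof. by elim: s1 => //= a s1 ->; rewrite step_mean. Qed.

(** The product formula for cosines, since [step a] acts on [x |-> cos (t * x)]
    as multiplication by [cos (t * a)]. Two nearly equal steps are thus, half
    of the time, one very short step: this is the source of all the fine-scale
    randomness of the walk. *)
Lemma step_step a b f x :
  step a (step b f) x = (step (a + b) f x + step (b - a) f x) / 2.
Proof.
rewrite /step.
rewrite -!addrA !opprD !opprK (addrC (- a) b) (addrC (- b) a); lra.
Qed.

Lemma mean_shift s f z x : mean s (fun y => f (z + y)) x = mean s f (z + x).
Proof. by elim: s x => //= a s IHs x; rewrite /step !IHs !addrA. Qed.

Lemma mean_opp s f x : mean s (fun y => f (- y)) x = mean s f (- x).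
Proof.
by elim: s x => //= a s IHs x; rewrite /step !IHs opprB !opprD addrC (addrC a).
Qed.

Lemma mean0N s f : mean s (fun y => f (- y)) 0 = mean s f 0.
Proof. by rewrite mean_opp oppr0. Qed.

End SignMean.

Lemma mean_map {R : realFieldType} {V W : zmodType} (phi : V -> W)
    (s : seq V) (f : W -> R) x : {morph phi : u v / u - v} ->
  mean (map phi s) f (phi x) = mean s (f \o phi) x.
Proof.
move=> phiB; elim: s x => //= a s IHs x; rewrite /step -!IHs phiB.
have phi0 : phi 0 = 0 by rewrite -(subrr 0) phiB subrr.
congr ((mean _ _ _ + _) / _); have -> : x + a = x - (0 - a) by rewrite sub0r opprK.
by rewrite !phiB phi0 sub0r opprK.
Qed.

Lemma mean_exchange {R : realFieldType} {V W : zmodType} (s : seq V)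
    (t : seq W) (F : V -> W -> R) x y :
  mean s (fun u => mean t (F u) y) x = mean t (fun w => mean s (F^~ w) x) y.
Proof.
elim: s x => //= a s IHs x; rewrite /step !IHs.
under [in RHS]eq_fun => w do rewrite /step mulrC.
by rewrite meanZ meanD mulrC.
Qed.

Section Moments.
Context {R : realFieldType}.
Implicit Types (s : seq R) (x t : R).

Lemma mean_sqr s x : mean s (fun y => y ^+ 2) x = x ^+ 2 + \sum_(a <- s) a ^+ 2.
Proof.
elim: s x => [|a s IHs] x /=; first by rewrite big_nil addr0.
by rewrite /step !IHs big_cons; lra.
Qed.

Lemma chebyshev s t : 0 < t ->
  mean s (fun y => ind (t <= `|y|)) 0 <= (\sum_(a <- s) a ^+ 2) / t ^+ 2.
Proof.
move=> t0; rewrite ler_pdivlMr ?exprn_gt0// mulrC -meanZ.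
rewrite -[leRHS]add0r -[X in X + _](expr0n R 2) -mean_sqr; apply: ler_mean => y.
case: (leP t `|y|) => [ty|_]; rewrite ?mulr1 ?mulr0 ?sqr_ge0//.
by rewrite -(real_normK (num_real y)) lerXn2r// nnegrE ltW.
Qed.

End Moments.

(** * The Littlewood-Offord bound *)

Section LittlewoodOfford.
Context {R : rcfType}.
Implicit Types (s ch : seq R) (w x y z : R).

Definition cell z w : R -> R := fun y => ind (z <= y < z + w).

(** Sequences sorted for this relation are the chains of the argument below. *)
Definition gap w : rel R := fun x y => x + w <= y.

(** The probability that the simple random walk started at [l] is not absorbed
    at [0] within [n] steps. *)
Fixpoint survive (n l : nat) : R :=
  match n, l with
  | _, 0 => 0
  | 0, _ => 1
  | n'.+1, l'.+1 => (survive n' l'.+2 + survive n' l') / 2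
  end.

Lemma gap_trans w : 0 < w -> transitive (gap w).
Proof. by rewrite /gap => w0 y x z xy yz; lra. Qed.

Lemma sum_cell_chain z w ch : 0 < w -> sorted (gap w) ch ->
  \sum_(x <- ch) cell z w x <= survive 0 (size ch).
Proof.
move=> w0; elim: ch => [|x ch IHch] /=; first by rewrite big_nil.
move=> pch; rewrite big_cons; have [zx|nzx] := boolP (z <= x < z + w); last first.
  rewrite /cell (negbTE nzx) add0r.
  by apply: le_trans (IHch (path_sorted pch)) _; case: (ch).
rewrite big_seq big1 ?addr0 ?/cell ?zx//= => y ych.
have /allP/(_ y ych) := order_path_min (gap_trans w0) pch; rewrite /gap => xy.
have /andP[zx1 zx2] := zx.
have /negbTE -> // : ~~ (z <= y < z + w) by rewrite negb_and -!ltNge -leNgt; lra.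
Qed.

(** Kleitman's argument: translate a chain by [a] and by [- a], and move the
    lowest point of the lower translate to the upper one. The two new chains
    keep their gaps since [w <= 2 * a], and they have one point more and one
    point less, so the length of the chain follows a simple random walk. *)
Lemma sum_mean_chain z w s ch : 0 < w -> all (fun a => w <= 2 * a) s ->
  sorted (gap w) ch ->
  \sum_(x <- ch) mean s (cell z w) x <= survive (size s) (size ch).
Proof.
move=> w0; elim: s ch => [|a s IHs] ch /=; first by move=> _; exact: sum_cell_chain.
move=> /andP[wa ws]; case: ch => [|x ch] /=; first by rewrite big_nil.
move=> pch; set g := mean s (cell z w).
have -> : \sum_(y <- x :: ch) step a g y =
    (\sum_(y <- (x - a) :: [seq y + a | y <- x :: ch]) g y +
     \sum_(y <- [seq y - a | y <- ch]) g y) / 2.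
  rewrite !big_cons !big_map /step -mulr_suml big_split/=; lra.
rewrite ler_pM2r ?invr_gt0 ?ltr0n//; apply: lerD.
  apply: le_trans (IHs _ ws _) _; last by rewrite /= size_map.
  rewrite /= /gap; apply/andP; split; first by lra.
  have /= -> := @path_map _ _ (fun y => y + a) (gap w) x ch; apply: sub_path pch => u v.
  by rewrite /gap/=; lra.
apply: le_trans (IHs _ ws _) _; last by rewrite /= size_map.
have := path_sorted pch; rewrite sorted_map; apply: sub_sorted => u v.
by rewrite /gap/=; lra.
Qed.

Lemma ind_itv (p q y : R) : p <= q ->
  ind (p < y <= q) = ind (p < y) - ind (q < y) :> R.
Proof.
move=> pq; rewrite leNgt; case: (ltrP q y) => [qy|_] /=; last first.
  by rewrite andbT subr0.
by rewrite (le_lt_trans pq qy) subrr.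
Qed.

(** The reflection principle for the walk absorbed at [0]. *)
Lemma survive_ballot n l :
  survive n l <= mean (nseq n 1) (fun y => ind (- l%:R < y <= l%:R)) 0.
Proof.
elim: n l => [|n IHn] [|l] //=.
- by rewrite oppr_lt0 ltr0n ler0n.
- by apply: (@mean_ge0 _ _ (1 :: nseq n 1)) => y; rewrite ler0n.
have -> : step 1 (mean (nseq n 1) (fun y : R => ind (- l.+1%:R < y <= l.+1%:R))) 0 =
    (mean (nseq n 1) (fun y : R => ind (- l.+2%:R < y <= l.+2%:R)) 0 +
     mean (nseq n 1) (fun y : R => ind (- l%:R < y <= l%:R)) 0) / 2 :> R.
  rewrite step_mean -meanD mulrC -meanZ; congr (mean _ _ _); apply/funext => y.
  rewrite /step mulrC; congr (_ * _).
  have l0 : 0 <= l%:R :> R by rewrite ler0n.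
  rewrite -(addn2 l) -(addn1 l) !natrD.
  rewrite !ind_itv; [|lra..].
  have -> : (- (l%:R + 1) < y + 1) = (- (l%:R + 2) < y) by apply/idP/idP; lra.
  have -> : (l%:R + 1 < y + 1) = (l%:R < y) by apply/idP/idP; lra.
  have -> : (- (l%:R + 1) < y - 1) = (- l%:R < y) by apply/idP/idP; lra.
  have -> : (l%:R + 1 < y - 1) = (l%:R + 2 < y) by apply/idP/idP; lra.
  lra.
by rewrite ler_pM2r ?invr_gt0 ?ltr0n// lerD.
Qed.

Lemma mean_nseq1 n (f : R -> R) x :
  mean (nseq n 1) f x = (\sum_(k < n.+1) 'C(n, k)%:R * f (x + n%:R - 2 * k%:R)) / 2 ^+ n.
Proof.
elim: n x => [|n IHn] x /=.
  by rewrite big_ord1 bin0 mul1r expr0 divr1 !mulr0n mulr0 subr0 addr0.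
rewrite /step !IHn -mulrDl -mulrA -invfM -exprSr; congr (_ / _).
rewrite [in RHS]big_ord_recl bin0 mul1r /=.
under [X in _ = _ + X]eq_bigr => k _ do rewrite /bump add1n binS natrD mulrDl.
rewrite big_split/= addrA; congr (_ + _); last first.
  by apply: eq_bigr => k _; congr (_ * f _); rewrite -addn1 -(addn1 k) !natrD; lra.
rewrite [in LHS]big_ord_recl/= bin0 mul1r; congr (_ + _).
  by congr f; rewrite -(addn1 n) natrD; lra.
rewrite [in RHS]big_ord_recr/= bin_small// mul0r addr0.
by apply: eq_bigr => k _; congr (_ * f _); rewrite /bump add1n -(addn1 n) natrD -addn1 natrD; lra.
Qed.

Lemma central_binS m : (m.+1 * 'C(2 * m.+1, m.+1) = 2 * (2 * m).+1 * 'C(2 * m, m))%N.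
Proof.
have := mul_bin_diag (2 * m).+1 m; rewrite /= => E.
have -> : (2 * m.+1 = (2 * m).+2)%N by lia.
rewrite binS -(@bin_sub (2 * m).+1 m); last by lia.
have -> : ((2 * m).+1 - m = m.+1)%N by lia.
by rewrite addnn -muln2 mulnA -E mulnC mulnA.
Qed.

(** The constants are those for which the bound on the central binomial
    coefficient is stable under induction; squaring keeps it in the integers. *)
Lemma central_bin_sqr m : ((2 * m).+1 * 'C(2 * m, m) ^ 2 <= 4 ^ (2 * m))%N.
Proof.
elim: m => // m IHm; rewrite -(@leq_pmul2r (m.+1 ^ 2)) ?expn_gt0//.
rewrite -mulnA -expnMn (mulnC 'C(_, _)) central_binS.
have -> : (4 ^ (2 * m.+1) = 16 * 4 ^ (2 * m))%N by rewrite mulnS expnD.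
move: IHm; rewrite -!mulnn; move: ('C(2 * m, m)) (4 ^ (2 * m))%N => b f IHm.
have := leq_mul (leqnn (4 * (2 * m).+1 * (2 * m).+3)%N) IHm; nia.
Qed.

Lemma half_bin_sqr n : (n.+1 * 'C(n, n./2) ^ 2 <= 4 ^ n)%N.
Proof.
rewrite -[n]odd_double_half; set m := n./2; case: (odd n) => /=.
  rewrite uphalf_double; have := central_bin_sqr m.+1.
  have -> : (2 * m.+1 = m.*2.+2)%N by lia.
  rewrite binS -(@bin_sub (m.*2).+1 m); last by lia.
  have -> : ((m.*2).+1 - m = m.+1)%N by lia.
  rewrite add1n -mul2n (expnS 4); move: ('C(_, _)) => b; rewrite -!mulnn; nia.
by rewrite add0n doubleK -mul2n; exact: central_bin_sqr.
Qed.

Lemma survive1_le n : survive n 1 <= (Num.sqrt n.+1%:R)^-1.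
Proof.
apply: le_trans (survive_ballot n 1) _; rewrite mean_nseq1.
have hn : (n./2 < n.+1)%N by lia.
rewrite (bigD1 (Ordinal hn))//= big1 ?addr0; last first.
  move=> k /eqP kn; rewrite add0r.
  have /negbTE -> : ~~ (- 1%:R < (n%:R : R) - 2 * k%:R <= 1%:R).
    apply/negP => /andP[h1 h2]; apply: kn; apply: val_inj => /=.
    have {}h1 : ((2 * k < n.+1)%N) by rewrite -(ltr_nat R) -natr1 natrM; lra.
    have {}h2 : ((n <= (2 * k).+1)%N) by rewrite -(ler_nat R) -natr1 natrM; lra.
    lia.
  by rewrite mulr0.
set b : R := ind _.
have b1 : b <= 1 by rewrite /b; case: (X in ind X); rewrite ?ler01.
rewrite ler_pdivrMr ?exprn_gt0// [leRHS]mulrC ler_pdivlMr ?sqrtr_gt0 ?ltr0n//.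
apply: le_trans (_ : 'C(n, n./2)%:R * Num.sqrt n.+1%:R <= _).
  by rewrite ler_wpM2r ?sqrtr_ge0// ler_piMr.
rewrite -(@ler_pXn2r _ 2) ?nnegrE ?mulr_ge0 ?sqrtr_ge0 ?exprn_ge0//.
rewrite exprMn sqr_sqrtr// -exprM mulnC exprM -!natrX -natrM ler_nat mulnC.
exact: half_bin_sqr.
Qed.

Lemma sum_cells (z w : R) (J : nat) y : 0 <= w ->
  \sum_(i < J) cell (z + i%:R * w) w y = cell z (J%:R * w) y.
Proof.
move=> w0; elim: J => [|J IHJ].
  rewrite big_ord0 /cell mul0r addr0.
  by have /negbTE -> : ~~ (z <= y < z) by apply/negP => /andP[]; lra.
rewrite big_ord_recr/= IHJ /cell -(addn1 J) natrD mulrDl mul1r addrA.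
have J0 : 0 <= J%:R * w by rewrite mulr_ge0.
by case: (lerP z y) => ?; case: (ltrP y (z + J%:R * w)) => ?;
  case: (lerP (z + J%:R * w) y) => ?; case: (ltrP y (z + J%:R * w + w)) => ? /=;
  rewrite ?addr0 ?add0r//; lra.
Qed.

(** One point is a chain of length one, and a window of length [J * w] is made of
    [J] cells. *)
Theorem littlewood_offord z w (J : nat) s x : 0 < w -> all (fun a => w <= 2 * a) s ->
  mean s (cell z (J%:R * w)) x <= J%:R / Num.sqrt (size s).+1%:R.
Proof.
move=> w0 ws.
have -> : cell z (J%:R * w) = fun y => \sum_(i < J) cell (z + i%:R * w) w y.
  by apply/funext => y; rewrite sum_cells// ltW.
rewrite mean_sum; apply: (@le_trans _ _ (\sum_(i < J) (Num.sqrt (size s).+1%:R)^-1)).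
  apply: ler_sum => i _; apply: le_trans (survive1_le _).
  by have := @sum_mean_chain (z + i%:R * w) w s [:: x] w0 ws isT; rewrite big_seq1.
by rewrite sumr_const card_ord mulr_natl.
Qed.

End LittlewoodOfford.

(** * Concentration at two scales *)

Section TwoScale.
Context {R : realType}.
Implicit Types (s D : seq R) (x y t : R).

Lemma sum_invsq (K : nat) : \sum_(k < K) (k.+1%:R ^+ 2)^-1 <= 2 :> R.
Proof.
suff H : \sum_(k < K.+1) (k.+1%:R ^+ 2)^-1 <= 2 - K.+1%:R^-1 :> R.
  apply: le_trans (_ : _ <= 2 - K.+1%:R^-1) _; last by rewrite gerBl.
  by apply: le_trans H; rewrite big_ord_recr/= lerDl invr_ge0 exprn_ge0.
elim: K => [|K IHK]; first by rewrite big_ord1 expr1n invr1; lra.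
rewrite big_ord_recr/= (le_trans (lerD IHK (lexx _)))// -[K.+2%:R]natr1.
have : 0 < K.+1%:R :> R by rewrite ltr0n.
move: (K.+1%:R : R) => k k0; rewrite -subr_ge0.
have -> : 2 - (k + 1)^-1 - (2 - k^-1 + ((k + 1) ^+ 2)^-1) = (k * (k + 1) ^+ 2)^-1.
  by field; apply/andP; split; lra.
by rewrite invr_ge0; nra.
Qed.

(** A large sum of two independent terms has a large term. Paying for the large
    one with Chebyshev leaves the other one free to be concentrated, which
    gives the concentration bound [Q] together with a quadratic tail. *)
Lemma mean_split_le D1 D2 (C Q v t x : R) (f := fun y => ind (`|y| <= C)) :
  0 < t -> C + 2 * t <= `|x| ->
  (forall y, mean D1 f y <= Q) -> (forall y, mean D2 f y <= Q) ->
  \sum_(a <- D1) a ^+ 2 <= v -> \sum_(a <- D2) a ^+ 2 <= v ->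
  mean (D1 ++ D2) f x <= 2 * Q * v / t ^+ 2.
Proof.
move=> t0 tx Q1 Q2 v1 v2.
have Q0 : 0 <= Q by apply: le_trans (Q1 0); apply: mean_ge0 => y; rewrite ler0n.
pose F u w := f (x + u + w).
have sh s (h : R -> R) y : mean s (fun z => h (y + z)) 0 = mean s h y.
  by rewrite mean_shift addr0.
have -> : mean (D1 ++ D2) f x = mean D1 (fun u => mean D2 (F u) 0) 0.
  rewrite mean_cat -sh; congr (mean _ _ _); apply/funext => u; exact/esym/sh.
have bad D : \sum_(a <- D) a ^+ 2 <= v ->
    mean D (fun u => Q * ind (t <= `|u|)) 0 <= Q * v / t ^+ 2.
  move=> Dv; rewrite meanZ -mulrA ler_wpM2l//; apply: le_trans (chebyshev _ t0) _.
  by rewrite ler_pM2r ?invr_gt0 ?exprn_gt0.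
have FQ1 u : mean D2 (F u) 0 <= Q by rewrite sh.
have FQ2 w : mean D1 (F^~ w) 0 <= Q.
  rewrite (_ : F^~ w = fun u => f (x + w + u)) ?sh//.
  by apply/funext => u; rewrite /F addrAC.
have le1 u w : F u w <= ind (t <= `|u|) * F u w + ind (t <= `|w|) * F u w.
  case: (lerP t `|u|) => tu; first by rewrite mul1r lerDl mulr_ge0.
  case: (lerP t `|w|) => tw; first by rewrite mul1r lerDr mulr_ge0.
  rewrite /F /f; case: (lerP `|x + u + w| C) => [h|_]; last by rewrite !mulr0 addr0.
  exfalso; have : `|x| <= `|x + u + w| + `|u| + `|w|.
    have {1}-> : x = x + u + w - u - w by lra.
    by rewrite (le_trans (ler_normB _ _))// lerD2r (le_trans (ler_normB _ _)).
  by lra.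
apply: le_trans (_ : mean D1 (fun u => Q * ind (t <= `|u|)) 0 +
    mean D2 (fun w => Q * ind (t <= `|w|)) 0 <= _); last first.
  by have := lerD (bad _ v1) (bad _ v2); lra.
have -> : mean D2 (fun w => Q * ind (t <= `|w|)) 0 =
    mean D1 (fun=> mean D2 (fun w => Q * ind (t <= `|w|)) 0) 0 by rewrite mean_cst.
apply: le_trans (_ : mean D1 (fun u => mean D2 (fun w => ind (t <= `|u|) * F u w) 0) 0 +
   mean D1 (fun u => mean D2 (fun w => ind (t <= `|w|) * F u w) 0) 0 <= _).
  rewrite -meanD; apply: ler_mean => u; rewrite -meanD; exact: ler_mean.
apply: lerD.
  by apply: ler_mean => u; rewrite meanZ mulrC ler_wpM2r.
rewrite mean_cst mean_exchange; apply: ler_mean => w.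
by rewrite meanZ mulrC ler_wpM2r.
Qed.

(** The coarse steps [M] locate the walk up to [r], with probability of order
    [1 / sqrt (size M)]; given the cell of length [r], the fine steps must hit
    the target, with probability [Q]. The two bounds multiply because the sum of
    the fine steps has a quadratic tail at scale [r], which makes the total
    weight of the cells bounded. *)
Lemma two_scale D1 D2 M (C Q r : R) x (f := fun y => ind (`|y| <= C)) :
  0 < r -> C <= r ->
  (forall y, mean D1 f y <= Q) -> (forall y, mean D2 f y <= Q) ->
  \sum_(a <- D1) a ^+ 2 <= r ^+ 2 -> \sum_(a <- D2) a ^+ 2 <= r ^+ 2 ->
  all (fun a => r <= 2 * a) M ->
  mean M (mean (D1 ++ D2) f) x <= 36 * Q / Num.sqrt (size M).+1%:R.
Proof.
move=> r0 Cr Q1 Q2 v1 v2 Mr.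
have Q0 : 0 <= Q by apply: le_trans (Q1 0); apply: mean_ge0 => y; rewrite ler0n.
(* [W i] bounds, up to [Q], the chance that the fine steps bring a point at
   distance about [i * r] to the target; its sum is at most [2 + 8 * 2]. *)
pose W (i : nat) : R := if (i < 2)%N then 1 else 8 / (i.-1)%:R ^+ 2.
have W0 i : 0 <= W i by rewrite /W; case: ifP => // _; rewrite mulr_ge0// invr_ge0 exprn_ge0.
pose shell i y : R := cell (i%:R * r) r y + cell (i%:R * r) r (- y).
have W18 I : \sum_(i < I) W i <= 18.
  have W1 : \sum_(i < I.+2) W i <= 18.
    rewrite 2!big_ord_recl /W /= -mulr_sumr.
    under eq_bigr => i _ do rewrite /bump/= !add1n /=.
    by have := sum_invsq I; lra.
  apply: le_trans W1; rewrite 2!big_ord_recr/= -addrA lerDl addr_ge0//.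
have idxP y : (Num.truncn (`|y| / r))%:R * r <= `|y| < (Num.truncn (`|y| / r)).+1%:R * r.
  rewrite -ler_pdivlMr// -ltr_pdivrMr//; apply: truncn_itv.
  by rewrite mulr_ge0// invr_ge0 ltW.
have gQ y : mean (D1 ++ D2) f y <= Q by rewrite mean_cat; exact: mean_le.
have fW y : mean (D1 ++ D2) f y <= Q * W (Num.truncn (`|y| / r)).
  have /andP[y1 y2] := idxP y; rewrite /W; case: ltnP => [_|i2]; first by rewrite mulr1.
  have i1 : 0 < (Num.truncn (`|y| / r)).-1%:R :> R by rewrite ltr0n; lia.
  have iE : (Num.truncn (`|y| / r))%:R = (Num.truncn (`|y| / r)).-1%:R + 1 :> R.
    by rewrite natr1 prednK//; lia.
  move: i1 iE y1; move: ((Num.truncn _).-1%:R : R) => i i1 -> y1.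
  have := @mean_split_le D1 D2 C Q (r ^+ 2) (i * r / 2) y _ _ Q1 Q2 v1 v2.
  rewrite (_ : 2 * Q * r ^+ 2 / _ = Q * (8 / i ^+ 2)); last first.
    by field; apply/andP; split; rewrite gt_eqF.
  by apply; nra.
have shell1 y : 1 <= shell (Num.truncn (`|y| / r)) y.
  have /andP[] := idxP y; rewrite /shell /cell -natr1 mulrDl mul1r => y1 y2.
  case: (lerP 0 y) => y0.
    by move: y1 y2; rewrite ger0_norm// => -> -> /=; rewrite lerDl ler0n.
  by move: y1 y2; rewrite ltr0_norm// => -> -> /=; rewrite lerDr ler0n.
have supp s y : C + \sum_(a <- s) `|a| < `|y| -> mean s f y = 0.
  elim: s y => [|a s IHs] y /=; first by rewrite big_nil addr0 /f leNgt => ->.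
  rewrite big_cons /step => ya; rewrite !IHs ?addr0 ?mul0r//.
    by have := lerB_dist y a; lra.
  by have := lerB_dist y (- a); rewrite normrN opprK; lra.
(* Beyond [I] cells the target is out of reach of the fine steps. *)
pose I := (Num.truncn ((C + \sum_(a <- D1 ++ D2) `|a|) / r)).+1.
apply: (@le_trans _ _ (mean M (fun y => \sum_(i < I) Q * W i * shell i y) x)).
  apply: ler_mean => y.
  have [/supp ->|yI] := ltrP (C + \sum_(a <- D1 ++ D2) `|a|) `|y|.
    apply: sumr_ge0 => i _; rewrite mulr_ge0 ?mulr_ge0// addr_ge0 ?ler0n//.
  have iI : (Num.truncn (`|y| / r) < I)%N.
    by rewrite ltnS; apply: le_truncn; rewrite ler_pM2r ?invr_gt0.
  rewrite (bigD1 (Ordinal iI))//= (le_trans (fW y))// -[leLHS]addr0 lerD//.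
    by rewrite ler_peMr// mulr_ge0.
  by apply: sumr_ge0 => i _; rewrite mulr_ge0 ?mulr_ge0// addr_ge0 ?ler0n.
rewrite mean_sum; set S := Num.sqrt _.
have shM i : mean M (shell i) x <= 2 / S.
  rewrite /shell meanD mean_opp.
  have h z := @littlewood_offord _ (i%:R * r) r 1 M z r0 Mr.
  by have := lerD (h x) (h (- x)); rewrite !mul1r /S; lra.
apply: (@le_trans _ _ (\sum_(i < I) Q * W i * (2 / S))).
  by apply: ler_sum => i _; rewrite meanZ ler_wpM2l ?mulr_ge0.
rewrite -mulr_suml -mulr_sumr.
have S0 : 0 <= S^-1 by rewrite invr_ge0 sqrtr_ge0.
rewrite mulrA ler_wpM2r//; have := ler_wpM2l Q0 (W18 I); lra.
Qed.

(** Each pair turns into its difference with probability one half, and once [n]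
    good differences have been collected the bound [b] holds whatever the
    other steps are. The error is Chernoff's bound for collecting fewer than
    [n] differences: [E 2^(- B) = 3 / 4] for a fair bit [B]. *)
Lemma mean_pairs_le (good : pred R) (g : R -> R) (n : nat) (b : R) :
  (forall y, 0 <= g y <= 1) -> 0 <= b ->
  (forall D, size D = n -> all good D -> forall x, mean D g x <= b) ->
  forall (ps : seq (R * R)) D x, (size D <= n)%N -> all good D ->
    all (fun p => good (p.2 - p.1)) ps ->
    mean D (mean (unzip1 ps) (mean (unzip2 ps) g)) x <=
      b + 2 ^+ (n - size D) * (3 / 4) ^+ size ps.
Proof.
move=> g01 b0 gb; have g1 y : g y <= 1 by case/andP: (g01 y).
have e0 i j : 0 <= 2 ^+ i * (3 / 4) ^+ j :> R by rewrite mulr_ge0 ?exprn_ge0//; lra.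
elim=> [|[a1 a2] ps IHps] D x; rewrite leq_eqVlt => /predU1P[Dn|Dn] Dg /=.
- by move=> _; rewrite (le_trans (gb _ Dn Dg _))// lerDl.
- move=> _; apply: (@le_trans _ _ 1); first exact: mean_le.
  by rewrite expr0 mulr1 ler_wpDl// exprn_ege1// ler1n.
- move=> _; rewrite -[step a1 _]/(mean (a1 :: unzip1 ps) (mean (a2 :: unzip2 ps) g)).
  rewrite !(meanC D); apply: le_trans (_ : b <= _).
    apply: mean_le => y; apply: mean_le => z.
    exact: gb.
  by rewrite lerDl.
move=> /andP[ga gps].
have -> : mean D (step a1 (mean (unzip1 ps) (step a2 (mean (unzip2 ps) g)))) x =
    (step (a1 + a2) (mean D (mean (unzip1 ps) (mean (unzip2 ps) g))) x +
     mean ((a2 - a1) :: D) (mean (unzip1 ps) (mean (unzip2 ps) g)) x) / 2.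
  by rewrite -step_mean -(step_mean a2 (unzip1 ps)) -step_mean step_step.
have -> : (2 : R) ^+ (n - size D) = 2 * 2 ^+ (n - (size D).+1) by rewrite -exprS subnSK.
have := IHps ((a2 - a1) :: D) x Dn; rewrite /= ga Dg => /(_ isT gps) h1.
have h2 : step (a1 + a2) (mean D (mean (unzip1 ps) (mean (unzip2 ps) g))) x <=
    b + 2 ^+ (n - size D) * (3 / 4) ^+ size ps.
  by apply: (@mean_le _ _ [:: a1 + a2]) => y; apply: IHps => //; exact: ltnW.
move: h1 h2; rewrite -(subnSK Dn) [2 ^+ _.+1]exprS [(3 / 4) ^+ _.+1]exprS /=.
by move: (2 ^+ _) ((3 / 4) ^+ size ps) => u v; lra.
Qed.
End TwoScale.

(** * Avoiding an interval *)

Section Avoidance.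
Context {R : realType}.
Context (a : nat -> R).
Implicit Types (C x y z d e th eps : R) (N k j m : nat).

(** The walk makes the step [a k] at time [k], so the first step after time [k]
    is [a k.+1]. *)
Definition seg k j : seq R := [seq a i | i <- iota k.+1 j].

(** The probability that the walk which is at [x] at time [k] stays out of
    [[- C, C]] during its next [j] steps, the times up to [N] being exempted. The
    exemption lets one function describe walks started at any time before the
    period under observation. *)
Fixpoint avoid C N j k x : R :=
  if j is j'.+1 then
    step (a k.+1) (fun y => if (N < k.+1)%N && (`|y| <= C) then 0
                            else avoid C N j' k.+1 y) x
  else 1.

(** The expected number of visits in the same setting. *)
Fixpoint visits C N j k x : R :=
  if j is j'.+1 then
    step (a k.+1) (fun y => ((N < k.+1)%N && (`|y| <= C))%:R + visits C N j' k.+1 y) x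
  else 0.

Lemma seg_cat k i j : seg k (i + j) = seg k i ++ seg (k + i) j.
Proof. by rewrite /seg iotaD map_cat addSn. Qed.

Lemma size_seg k j : size (seg k j) = j.
Proof. by rewrite size_map size_iota. Qed.

Lemma seg_all (p : pred R) k j :
  (forall i, (k < i <= k + j)%N -> p (a i)) -> all p (seg k j).
Proof.
by move=> H; apply/allP => _ /mapP[i + ->]; rewrite mem_iota => hi; apply: H; lia.
Qed.

Lemma step_cst b (q x : R) : step b (fun=> q) x = q :> R.
Proof. exact: (mean_cst [:: b]). Qed.

Lemma avoid01 C N j k x : 0 <= avoid C N j k x <= 1.
Proof.
elim: j k x => [|j IHj] k x /=; first by rewrite ler01 lexx.
rewrite -{1}(step_cst (a k.+1) 0 x) -(step_cst (a k.+1) 1 x).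
by apply/andP; split; apply: ler_step => y; case: ifP => // _; case/andP: (IHj k.+1 y).
Qed.

Lemma avoid_ge0 C N j k x : 0 <= avoid C N j k x.
Proof. by case/andP: (avoid01 C N j k x). Qed.

Lemma avoid_le1 C N j k x : avoid C N j k x <= 1.
Proof. by case/andP: (avoid01 C N j k x). Qed.

Lemma avoidN C N j k x : avoid C N j k (- x) = avoid C N j k x.
Proof.
elim: j k x => //= j IHj k x; rewrite /step.
have -> : - x + a k.+1 = - (x - a k.+1) by lra.
have -> : - x - a k.+1 = - (x + a k.+1) by lra.
by rewrite !normrN !IHj addrC.
Qed.

Lemma avoid_homo C N N' j k x : (N <= N')%N -> avoid C N j k x <= avoid C N' j k x.
Proof.
move=> NN'; elim: j k x => //= j IHj k x; apply: ler_step => y.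
have [h'|_] := boolP ((N' < k.+1)%N && (`|y| <= C)).
  by have -> : (N < k.+1)%N && (`|y| <= C) by move: h' => /andP[h ->]; rewrite andbT; lia.
by case: ifP => _; [exact: avoid_ge0|exact: IHj].
Qed.

(** Two walks that use the same signs keep their distance. *)
Lemma avoid_near C e N j k x d : `|d| <= e ->
  avoid (C + e) N j k x <= avoid C N j k (x + d).
Proof.
move=> de; elim: j k x => //= j IHj k x; rewrite /step ler_pM2r ?invr_gt0//.
suff H y : (if (N < k.+1)%N && (`|y| <= C + e) then 0 else avoid (C + e) N j k.+1 y) <=
    (if (N < k.+1)%N && (`|y + d| <= C) then 0 else avoid C N j k.+1 (y + d)).
  by rewrite !(addrAC x d); exact: lerD.
have [/andP[-> h]|_] := boolP ((N < k.+1)%N && (`|y + d| <= C)).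
  suff -> : `|y| <= C + e by [].
  by rewrite -[y](addrK d) (le_trans (ler_normB _ _))// lerD.
by case: ifP => _; [exact: avoid_ge0|exact: IHj].
Qed.

(** Only finitely many positions are reachable at time [k + i], so the horizons
    that suit each of them have a common upper bound. *)
Lemma avoid_restart C N i k x th :
  (forall y, exists j0, forall j, (j0 <= j)%N -> avoid C N j (k + i) y <= th) ->
  exists j0, forall j, (j0 <= j)%N ->
    avoid C N (i + j) k x <= th * avoid C N i k x.
Proof.
elim: i k x => [|i IHi] k x H.
  by have [j0 h] := H x; exists j0 => j /h; rewrite mulr1 addn0.
have H' y : exists j0, forall j, (j0 <= j)%N -> avoid C N j (k.+1 + i) y <= th.
  by have := H y; rewrite addSnnS.
have [j1 h1] := IHi k.+1 (x + a k.+1) H'.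
have [j2 h2] := IHi k.+1 (x - a k.+1) H'.
exists (maxn j1 j2) => j; rewrite geq_max => /andP[/h1 {}h1 /h2 {}h2] /=.
rewrite /step; do 2 case: ifP => _; rewrite ?add0r ?addr0 ?mul0r ?mulr0//; lra.
Qed.

Lemma visits_sum C N j k x :
  visits C N j k x = \sum_(i < j) (N < k + i.+1)%N%:R *
     mean (seg k i.+1) (fun y => ind (`|y| <= C)) x.
Proof.
elim: j k x => [|j IHj] k x; first by rewrite big_ord0.
rewrite big_ord_recl /=.
have -> : (fun y => ((N < k.+1)%N && (`|y| <= C))%:R + visits C N j k.+1 y) =
   fun y => (N < k + 1)%N%:R * ind (`|y| <= C) + \sum_(i < j) (N < k.+1 + i.+1)%N%:R *
     mean (seg k.+1 i.+1) (fun y => ind (`|y| <= C)) y.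
  by apply/funext => y; rewrite IHj addn1 -natrM mulnb.
rewrite -[LHS]/(mean [:: a k.+1] _ x) meanD meanZ mean_sum; congr (_ + _).
by apply: eq_bigr => i _; rewrite meanZ /= addSnnS.
Qed.

(** First-visit decomposition: if no visit is followed by more than [B - 1]
    expected visits, then the expected number of visits is at most [B] times
    the probability of making one. *)
Lemma visits_avoid C N j k x (B : R) :
  (forall j' k' y, (N < k')%N -> (k' + j' = k + j)%N -> `|y| <= C ->
     1 + visits C N j' k' y <= B) ->
  visits C N j k x <= B * (1 - avoid C N j k x).
Proof.
elim: j k x => [|j IHj] k x H /=; first by rewrite subrr mulr0.
set v := fun y => _ + visits _ _ _ _ y; set u := fun y => if _ then _ else _.
have vu y : v y <= B * (1 - u y).
  rewrite /v /u; case: ifP => [/andP[Nk yC]|_].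
    by rewrite subr0 mulr1; apply: H => //; lia.
  by rewrite add0r; apply: IHj => j' k' z h1 h2; apply: H => //; lia.
by have := vu (x + a k.+1); have := vu (x - a k.+1); rewrite /step; lra.
Qed.

(** * Coupling by mirrored steps *)

(** What a coupling of two walks at distance [d] yields: if only late times are
    observed, then up to probability [th] one of them comes within [C + e] of
    the origin when the other one comes within [C]. *)
Definition coupled C e k d th := exists N1, forall N j x, (N1 <= N)%N ->
  avoid (C + e) N j k x <= avoid C N j k (x + d) + th.

Lemma coupled_near C e k d : `|d| <= e -> coupled C e k d 0.
Proof. by move=> de; exists 0 => N j x _; rewrite addr0; exact: avoid_near. Qed.

Lemma coupled_le C e k d th th' : th <= th' -> coupled C e k d th -> coupled C e k d th'.
Proof. by move=> le [N1 h]; exists N1 => N j x /h{}h; rewrite (le_trans (h j x))// lerD2l. Qed.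

Lemma coupledN C e k d th : coupled C e k (- d) th -> coupled C e k d th.
Proof.
move=> [N1 h]; exists N1 => N j x /h{}h.
by have := h j (- x); rewrite avoidN -opprD avoidN.
Qed.

Lemma coupled_parallel C e k d th : 0 <= th -> coupled C e k.+1 d th -> coupled C e k d th.
Proof.
move=> th0 [N1 h]; exists (maxn N1 k.+1) => N [|j] x; rewrite geq_max => /andP[/h{}h kN] /=.
  by rewrite lerDl.
have -> /= : (N < k.+1)%N = false by lia.
rewrite /step.
have := h j (x + a k.+1); have := h j (x - a k.+1).
by rewrite !(addrAC x _ d); lra.
Qed.

Lemma coupled_parallels C e i k d th : 0 <= th ->
  coupled C e (k + i) d th -> coupled C e k d th.
Proof.
move=> th0; elim: i k => [|i IHi] k; first by rewrite addn0.
by rewrite -addSnnS => /IHi; exact: coupled_parallel.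
Qed.

(** Using opposite signs for one step changes the distance by twice that step,
    up or down. *)
Lemma coupled_mirror C e k d th1 th2 : 0 <= th1 -> 0 <= th2 ->
  coupled C e k.+1 (d - 2 * a k.+1) th1 -> coupled C e k.+1 (d + 2 * a k.+1) th2 ->
  coupled C e k d ((th1 + th2) / 2).
Proof.
move=> p1 p2 [N1 h1] [N2 h2]; exists (maxn (maxn N1 N2) k.+1) => N [|j] x.
  by move=> _ /=; lra.
rewrite !geq_max => /andP[/andP[/h1{}h1 /h2{}h2] kN] /=.
have -> /= : (N < k.+1)%N = false by lia.
rewrite /step.
have := h1 j (x + a k.+1); have := h2 j (x - a k.+1).
have -> : x - a k.+1 + (d + 2 * a k.+1) = x + d + a k.+1 by lra.
have -> : x + a k.+1 + (d - 2 * a k.+1) = x + d - a k.+1 by lra.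
lra.
Qed.

(** Steps grow slowly and without bound, so once [2 * a k.+1 <= d] one may use
    equal signs until twice the current step is within [e] of [d], and mirror
    that single step. With probability one half the distance drops to at most
    [e], and otherwise the game goes on with a new distance. A distance that is
    too small for the current step is first mirrored at once: it increases
    with probability one half, hence the factor [3 / 4] per round. *)
Theorem coupling C e n1 : 0 < e ->
  (forall M n, exists2 k, (n <= k)%N & M < a k) ->
  (forall k, (n1 <= k)%N -> 2 * (a k.+1 - a k) <= e) ->
  forall J k d, (n1 <= k)%N -> coupled C e k d ((3 / 4) ^+ J).
Proof.
move=> e0 a_unbounded a_slow; elim=> [|J IHJ] k d kn.
  by exists 0 => N j x _; rewrite expr0 (le_trans (avoid_le1 _ _ _ _ _))// lerDr avoid_ge0.
have th0 : 0 <= (3 / 4 : R) ^+ J by rewrite exprn_ge0//; lra.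
have big k' d' : (n1 <= k')%N -> 2 * a k'.+1 <= d' -> coupled C e k' d' ((3 / 4) ^+ J / 2).
  move=> kn' ad.
  have ex : exists i, d' < 2 * a (k'.+1 + i).
    have [i ki di] := a_unbounded (d' / 2) k'.+1.
    by exists (i - k'.+1)%N; rewrite subnKC//; lra.
  case: (ex_minnP ex) => -[|i] di imin; first by exfalso; rewrite addn0 in di; lra.
  have {}imin : 2 * a (k' + i).+1 <= d'.
    by rewrite leNgt -addSn; apply/negP => /imin; rewrite ltnn.
  apply: (@coupled_parallels _ _ i); first by lra.
  rewrite -[_ / 2](_ : (0 + (3 / 4) ^+ J) / 2 = _); last by rewrite add0r.
  apply: coupled_mirror => //; last by apply: IHJ; lia.
  apply: coupled_near; have := a_slow (k' + i).+1; rewrite ger0_norm; last by lra.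
  by move: di; rewrite addSn addnS => di /(_ ltac:(lia)); lra.
wlog d0 : d / 0 <= d.
  by move=> H; case: (lerP 0 d) => [/H//|d0]; apply: coupledN; apply: H; lra.
have [de|ed] := lerP d e.
  by apply: coupled_le (coupled_near _ _ _); rewrite ?exprn_ge0 ?ger0_norm//; lra.
have [ad|da] := lerP (2 * a k.+1) d.
  by apply: coupled_le (big _ _ kn ad); rewrite exprS; lra.
apply: (@coupled_le _ _ _ _ (((3 / 4) ^+ J + (3 / 4) ^+ J / 2) / 2)); first by rewrite exprS; lra.
apply: coupled_mirror => //; first by apply: IHJ; lia.
by apply: big; [lia|have := a_slow k.+1 ltac:(lia); lra].
Qed.

Lemma geometric_small z eps : 0 <= z < 1 -> 0 < eps -> exists n, z ^+ n <= eps.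
Proof.
move=> /andP[z0 z1] e0; have z1' : `|z| < 1 by rewrite ger0_norm.
have /cvgrPdist_le/(_ _ e0)[n _ /(_ n (leqnn n))] := cvg_expr z1'.
by rewrite sub0r normrN ger0_norm ?exprn_ge0//; exists n.
Qed.

(** The coupling transports the chance [q] of a hit from walks at the origin to
    walks anywhere, at the cost of half of it. Repeated attempts then leave no
    chance of avoiding the interval forever. *)
Theorem avoid_vanishes C e n1 (q : R) N : 0 < e ->
  (forall M n, exists2 k, (n <= k)%N & M < a k) ->
  (forall k, (n1 <= k)%N -> 2 * (a k.+1 - a k) <= e) ->
  0 < q ->
  (forall k N, (n1 <= k)%N -> exists N' j, (N <= N')%N /\ avoid C N' j k 0 <= 1 - q) ->
  forall eps, 0 < eps -> exists j, avoid (C + e) N j 0 0 <= eps.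
Proof.
move=> e0 a_unb a_slow q0 hit0.
have q1 : q <= 1.
  have [N' [j [_ h]]] := hit0 n1 0%N (leqnn _).
  by rewrite -subr_ge0; exact: le_trans (avoid_ge0 _ _ _ _ _) h.
have q20 : 0 < q / 2 by lra.
have [|J hJ] := @geometric_small (3 / 4) (q / 2) _ q20; first lra.
have hit k x : (n1 <= k)%N -> (N <= k)%N ->
    exists j, avoid (C + e) N j k x <= 1 - q / 2.
  move=> kn kN; have [N1 h1] := coupling C e0 a_unb a_slow J (- x) kn.
  have [N' [j [N1' hj]]] := hit0 k (maxn k N1) kn.
  exists j; apply: le_trans (avoid_homo (N' := N') _ _ _ _ _) _; first by lia.
  by have := h1 N' j x; rewrite subrr => /(_ ltac:(lia)); lra.
have many r k x : (n1 <= k)%N -> (N <= k)%N ->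
    exists j0, forall j, (j0 <= j)%N -> avoid (C + e) N j k x <= (1 - q / 2) ^+ r.
  elim: r k x => [|r IHr] k x kn kN.
    by exists 0%N => j _; exact: avoid_le1.
  have [i hi] := hit k x kn kN.
  have [j0 h0] := @avoid_restart (C + e) N i k x ((1 - q / 2) ^+ r)
    (fun y => IHr (k + i)%N y (leq_trans kn (leq_addr _ _)) (leq_trans kN (leq_addr _ _))).
  exists (i + j0)%N => j ij; rewrite -(subnKC (leq_trans (leq_addr _ _) ij)).
  apply: le_trans (h0 _ _) _; first by lia.
  by rewrite exprSr ler_wpM2l// exprn_ge0//; lra.
move=> eps eps0; have [|r hr] := @geometric_small (1 - q / 2) eps _ eps0; first lra.
have [j0 h0] := @avoid_restart (C + e) N (maxn n1 N) 0 0 ((1 - q / 2) ^+ r)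
    (fun y => many r _ y (leq_maxl _ _) (leq_maxr _ _)).
exists (maxn n1 N + j0)%N; apply: le_trans (h0 j0 (leqnn _)) _; apply: le_trans hr.
by rewrite ler_piMr ?avoid_le1// exprn_ge0//; lra.
Qed.

End Avoidance.

(** * A lower bound on the return probability *)

Section PairReturn.
Context {R : realType}.

(** If the steps come in pairs [(e, e + d)], the sums of the first and of the
    second entries are nearly independent copies of one variable, and by
    symmetry the walk returns when the two copies almost coincide. Cutting
    [[- B, B]] into [J] cells of length [C / 2], the copies share a cell with
    probability at least the sum of the squares of the cell probabilities,
    hence at least of order [1 / J]. *)
Lemma pair_return (ps : seq (R * R)) (C B : R) (J : nat) :
  0 < C -> 0 < B -> 4 * B <= J%:R * C ->
  4 * (\sum_(p <- ps) p.1 ^+ 2) <= B ^+ 2 ->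
  16 * (\sum_(p <- ps) p.2 ^+ 2) <= C ^+ 2 ->
  (4 * J%:R)^-1 <= mean (R := R) [seq p.1 | p <- ps]
    (mean [seq p.1 + p.2 | p <- ps] (fun y => ind (`|y| <= C) : R)) 0.
Proof.
move=> C0 B0 BJ v1 v2; set f := fun y : R => _; set E := [seq p.1 | p <- ps].
have J0 : 0 < J%:R :> R by rewrite -(pmulr_lgt0 _ C0); lra.
pose w := C / 2; have w0 : 0 < w by rewrite /w; lra.
pose cl i := cell (- B + i%:R * w) w.
pose F i (p : R * R) : R := cl i p.1 * ind (`|p.2| <= w).
have cl01 i y : 0 <= cl i y <= 1 by exact: ind01.
have mfst (g : R -> R) : mean ps (fun p => g p.1) 0 = mean E g 0.
  by rewrite -[in RHS](_ : (0 : R * R).1 = 0)// mean_map.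
have msnd (g : R -> R) : mean ps (fun p => g p.2) 0 = mean [seq p.2 | p <- ps] g 0.
  by rewrite -[in RHS](_ : (0 : R * R).2 = 0)// mean_map.
have -> : mean E (mean [seq p.1 + p.2 | p <- ps] f) 0 =
    mean ps (fun p => mean E (fun y => f (p.1 + p.2 - y)) 0) 0.
  rewrite meanC -[X in _ X = _](_ : (0 : R * R).1 + (0 : R * R).2 = 0); last exact: addr0.
  rewrite (mean_map (phi := fun p => p.1 + p.2)); last by move=> u v /=; lra.
  congr (mean _ _ _); apply/funext => p /=.
  rewrite -[LHS](_ : mean E (fun y => f (p.1 + p.2 + y)) 0 = _); first by rewrite -mean0N.
  by rewrite mean_shift addr0.
have pointwise (p : R * R) y : \sum_(i < J) F i p * cl i y <= f (p.1 + p.2 - y).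
  have [p2|p2] := lerP `|p.2| w; last first.
    by rewrite big1 ?ler0n// => i _; rewrite /F leNgt p2 mulr0 mul0r.
  have [py|py] := lerP `|p.1 - y| w; last first.
    rewrite big1 ?ler0n// => i _; rewrite /F.
    suff -> : cl i p.1 * ind (`|p.2| <= w) * cl i y = ind (`|p.2| <= w) * (cl i p.1 * cl i y).
      suff -> : cl i p.1 * cl i y = 0 by rewrite mulr0.
      rewrite /cl /cell -natrM mulnb; move: py.
      case: andP => [[/andP[h1 h2] /andP[h3 h4]]|//].
      by move: (- B + _) h1 h2 h3 h4 => z h1 h2 h3 h4; rewrite ltNge ler_norml => /negP[]; lra.
    by rewrite mulrAC mulrC.
  rewrite (_ : f _ = 1); last first.
    rewrite /f; suff -> : `|p.1 + p.2 - y| <= C by [].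
    by rewrite addrAC (splitr C) (le_trans (ler_normD _ _))// lerD.
  apply: (@le_trans _ _ (\sum_(i < J) cl i p.1)).
    apply: ler_sum => i _; rewrite /F p2 mulr1.
    by have /andP[? ?] := cl01 i p.1; have /andP[? ?] := cl01 i y; rewrite ler_piMr.
  by rewrite sum_cells ?(ltW w0)//; exact: ind_le1.
pose q (i : 'I_J) := mean ps (F i) 0.
have qle (i : 'I_J) : q i <= mean E (cl i) 0.
  rewrite -mfst; apply: ler_mean => p; rewrite /F ler_piMr ?ind_le1//.
have q0 (i : 'I_J) : 0 <= q i.
  by apply: mean_ge0 => p; rewrite /F mulr_ge0 ?ler0n//.
have qsum : 1 / 2 <= \sum_(i < J) q i.
  rewrite -mean_sum.
  apply: (@le_trans _ _ (1 - mean E (fun y => ind (B <= `|y|)) 0 -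
      mean [seq p.2 | p <- ps] (fun y => ind (w <= `|y|)) 0)).
    have h1 := chebyshev E B0; have h2 := chebyshev [seq p.2 | p <- ps] w0.
    rewrite !big_map in h1 h2.
    have {}h1 := le_trans h1 (_ : _ <= 1 / 4).
    have {}h2 := le_trans h2 (_ : _ <= 1 / 4).
    have := h1 ltac:(rewrite ler_pdivrMr ?exprn_gt0//; lra).
    have := h2 ltac:(rewrite ler_pdivrMr ?exprn_gt0// /w; lra).
    lra.
  have -> : 1 - mean E (fun y => ind (B <= `|y|)) 0 -
      mean [seq p.2 | p <- ps] (fun y => ind (w <= `|y|)) 0 =
    mean ps (fun p => 1 + (-1 * ind (B <= `|p.1|) + -1 * ind (w <= `|p.2|))) 0 :> R.
    rewrite !meanD !meanZ mean_cst (mfst (fun y => ind (B <= `|y|))).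
    by rewrite (msnd (fun y => ind (w <= `|y|))); lra.
  apply: ler_mean => p; rewrite -mulr_suml sum_cells ?(ltW w0)// /cell.
  have c0 b1 b2 : 0 <= (ind b1 : R) * ind b2 by rewrite mulr_ge0 ?ler0n.
  have [p1|p1] := lerP B `|p.1|.
    by apply: le_trans (c0 _ _); have := ler0n R (w <= `|p.2|)%R; rewrite /=; lra.
  have [p2|p2] := lerP w `|p.2|; first by apply: le_trans (c0 _ _); rewrite /=; lra.
  rewrite (ltW p2) !mulr0 !addr0 mulr1; move: p1; rewrite ltr_norml => /andP[h1 h2].
  by have -> : - B <= p.1 < - B + J%:R * w by apply/andP; split; rewrite /w; lra.
(* Cauchy-Schwarz, in the form of a square completed around the mean value. *)
apply: le_trans (_ : \sum_(i < J) q i ^+ 2 <= _).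
  apply: (@le_trans _ _ (\sum_(i < J) (J%:R^-1 * q i - (4 * J%:R ^+ 2)^-1))); last first.
    apply: ler_sum => i _; rewrite -subr_ge0.
    rewrite (_ : _ - _ = (q i - (2 * J%:R)^-1) ^+ 2) ?sqr_ge0//.
    by field; rewrite gt_eqF.
  rewrite sumrB -mulr_sumr sumr_const card_ord -[_ *+ J]mulr_natl.
  rewrite -subr_ge0 (_ : _ - _ = J%:R^-1 * (\sum_(i < J) q i - 1 / 2)); last by field; rewrite gt_eqF.
  by rewrite mulr_ge0 ?invr_ge0 ?subr_ge0.
apply: le_trans (_ : \sum_(i < J) q i * mean E (cl i) 0 <= _).
  by apply: ler_sum => i _; rewrite expr2 ler_wpM2l.
apply: le_trans (_ : mean ps (fun p => \sum_(i < J) F i p * mean E (cl i) 0) 0 <= _).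
  rewrite mean_sum; apply: ler_sum => i _; rewrite mulrC -meanZ.
  by apply: ler_mean => p; rewrite mulrC.
apply: ler_mean => p.
apply: le_trans (_ : mean E (fun y => \sum_(i < J) F i p * cl i y) 0 <= _); last exact: ler_mean.
by rewrite mean_sum; apply: ler_sum => i _; rewrite meanZ.
Qed.

Lemma sum_invsqrt (M : nat) :
  \sum_(i < M) (Num.sqrt i.+1%:R)^-1 <= 2 * Num.sqrt M%:R :> R.
Proof.
elim: M => [|M IHM]; first by rewrite big_ord0 mulr_ge0 ?sqrtr_ge0.
rewrite big_ord_recr/= (le_trans (lerD IHM (lexx _)))//.
have : 0 < Num.sqrt M.+1%:R :> R by rewrite sqrtr_gt0.
have : 0 <= Num.sqrt M%:R :> R by rewrite sqrtr_ge0.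
have : Num.sqrt M.+1%:R ^+ 2 = Num.sqrt M%:R ^+ 2 + 1 :> R by rewrite !sqr_sqrtr// natr1.
move: (Num.sqrt M.+1%:R) (Num.sqrt M%:R) => x y xy y0 x0.
rewrite -(ler_pM2r x0) mulrDl mulVf ?gt_eqF//; nra.
Qed.

Lemma ln_diff (x y : R) : 0 < y -> y <= x ->
  (x - y) / x <= ln x - ln y <= (x - y) / y.
Proof.
move=> y0 yx; have x0 : 0 < x by lra.
have h (u v : R) : 0 < u -> 0 < v -> ln u - ln v <= (u - v) / v.
  move=> u0 v0; rewrite -ln_div ?posrE//.
  have -> : u / v = 1 + (u - v) / v by field; lra.
  apply: le_ln1Dx; rewrite ltr_pdivlMr//; lra.
apply/andP; split; last exact: h.
have := h y x y0 x0; rewrite -[y - x]opprB mulNr; lra.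
Qed.

End PairReturn.

(** * Logarithmic steps *)

Section LogWalk.
Context {R : realType}.
Implicit Types (a : nat -> R) (c C : R).

Definition logsteps c : nat -> R := fun k => c * ln k%:R.

Lemma mean_interleave a n i (f : R -> R) :
  mean (seg a n (2 * i)) f =
  mean [seq a (n + 2 * t).+1 | t <- iota 0 i]
    (mean [seq a (n + 2 * t).+2 | t <- iota 0 i] f).
Proof.
elim: i f => [|i IHi] f; first by rewrite muln0.
rewrite mulnSr seg_cat mean_cat IHi -[in RHS](addn1 i) iotaD !map_cat !mean_cat /=.
by rewrite add0n step_mean.
Qed.

Lemma coarse_return a C w m j x : 2 * C < w ->
  0 < w -> (forall i, (m < i <= m + j)%N -> w <= 2 * a i) ->
  mean (seg a m j) (fun y => ind (`|y| <= C) : R) x <= (Num.sqrt j.+1%:R)^-1.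
Proof.
move=> Cw w0 wa; have := @littlewood_offord _ (- C) w 1 (seg a m j) x w0 (@seg_all _ a (fun b => w <= 2 * b) _ _ wa).
rewrite !mul1r size_seg; apply: le_trans; apply: ler_mean => y.
rewrite /cell; case: (lerP `|y| C) => // /[1!ler_norml] /andP[y1 y2].
by have -> : - C <= y < - C + w by lra.
Qed.

Lemma ln2_bounds : 1 / 2 <= (ln 2 : R) <= 1.
Proof. by have := @ln_diff R 2 1 ltac:(lra) ltac:(lra); rewrite ln1; lra. Qed.

Lemma ln_pow2 l : ln (2 ^ l)%:R = l%:R * ln 2 :> R.
Proof. by rewrite natrX lnXn// mulr_natl. Qed.

Lemma logsteps_ge c l k : 0 < c -> (2 ^ l <= k)%N -> c * l%:R <= 2 * logsteps c k.
Proof.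
move=> c0 lk; rewrite /logsteps mulrCA ler_pM2l//.
have : ln (2 ^ l)%:R <= ln k%:R :> R.
  by rewrite ler_ln ?posrE ?ler_nat// ltr0n ?expn_gt0//; apply: leq_trans lk; rewrite expn_gt0.
rewrite ln_pow2; have /andP[h _] := ln2_bounds.
have := ler_wpM2l (ler0n R l) h; lra.
Qed.

Lemma logsteps_le c l k : 0 < c -> (0 < k)%N -> (k <= 2 ^ l)%N -> logsteps c k <= c * l%:R.
Proof.
move=> c0 k0 lk; rewrite /logsteps ler_pM2l//.
have : ln k%:R <= ln (2 ^ l)%:R :> R.
  by rewrite ler_ln ?posrE ?ler_nat// ltr0n ?expn_gt0.
rewrite ln_pow2; have /andP[_ h] := ln2_bounds.
have := ler_wpM2l (ler0n R l) h; lra.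
Qed.

Lemma logsteps_diff c k p : 0 < c -> (0 < k)%N ->
  c * (p%:R / (p + k)%:R) <= logsteps c (p + k) - logsteps c k <= c * (p%:R / k%:R).
Proof.
move=> c0 k0; rewrite /logsteps -mulrBr !ler_pM2l//.
have := @ln_diff R (p + k)%:R k%:R.
by rewrite ltr0n k0 ler_nat leq_addl natrD addrK; apply.
Qed.

(** The first [2 * p] steps are paired at distance [p]. With [p = N / l ^ 2] the
    difference of such a pair is [c / l ^ 2] up to a constant, so [l ^ 6] of the
    differences have standard deviation of order [c * l], the size of a step,
    and by the Littlewood-Offord bound they hit an interval of fixed length with
    probability of order [1 / l]. This gains the factor [1 / l] over
    [coarse_return]. *)
Lemma fine_return c C N p l m j x : 0 < c -> 0 < C -> 2 * C < c * l%:R ->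
  (0 < p)%N -> (p * l ^ 2 = N)%N -> (2 ^ l = N)%N ->
  (N <= m)%N -> (m + j <= 8 * N)%N -> (4 * p <= j)%N ->
  mean (seg (logsteps c) m j) (fun y => ind (`|y| <= C) : R) x <=
    72 * ((8 * C / c + 1) / l%:R) / Num.sqrt j%:R + 2 ^+ (l ^ 6 + l ^ 6) * (3 / 4) ^+ p.
Proof.
move=> c0 C0 Cl p0 pN lN Nm mN pj; set f := fun y : R => _.
have l0 : 0 < l%:R :> R by rewrite -(pmulr_rgt0 _ c0); lra.
have l1 : 1 <= l%:R :> R by move: l0; rewrite ltr0n ler1n.
set Q := (8 * C / c + 1) / l%:R.
have Q0 : 0 <= Q by rewrite divr_ge0 ?ler0n// addr_ge0// divr_ge0 ?mulr_ge0 ?ltW.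
pose v := c / (8 * l%:R ^+ 2); pose v' := c / l%:R ^+ 2.
have v0 : 0 < v by rewrite divr_gt0// mulr_gt0// exprn_gt0.
pose good (d : R) := v <= d <= v'.
have goodQ D y : size D = (l ^ 6)%N -> all good D -> mean D f y <= Q.
  move=> Dl Dg; pose J := (Num.truncn (8 * C * l%:R ^+ 2 / c)).+1.
  have JC : C < J%:R * v.
    have := truncnS_gt (8 * C * l%:R ^+ 2 / c); rewrite -/J => J1.
    rewrite -[C](_ : 8 * C * l%:R ^+ 2 / c * v = C); first by rewrite ltr_pM2r.
    by rewrite /v; field; rewrite !gt_eqF.
  have J1 : J%:R <= (8 * C / c + 1) * l%:R ^+ 2.
    rewrite /J -[leLHS]natr1 [leRHS]mulrDl; apply: lerD; last by rewrite mul1r exprn_ege1.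
    rewrite mulrAC truncn_le.
    by rewrite mulr_ge0 ?divr_ge0 ?mulr_ge0 ?exprn_ge0// ltW.
  apply: (@le_trans _ _ (mean D (cell (- C) (J%:R * (2 * v))) y)).
    apply: ler_mean => z; rewrite /f /cell.
    case: (lerP `|z| C) => // /[1!ler_norml] /andP[z1 z2].
    by have -> : - C <= z < - C + J%:R * (2 * v) by lra.
  have Dv : all (fun d => 2 * v <= 2 * d) D.
    by apply: sub_all Dg => d /andP[vd _]; rewrite ler_pM2l.
  apply: le_trans (@littlewood_offord _ (- C) (2 * v) J D y _ Dv) _; first lra.
  rewrite Dl; have S : l%:R ^+ 3 <= Num.sqrt (l ^ 6).+1%:R :> R.
    rewrite -[leLHS]ger0_norm ?exprn_ge0// -sqrtr_sqr -exprM ler_sqrt ?ler0n//.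
    by rewrite -natr1 natrX lerDl.
  have S0 : 0 < Num.sqrt (l ^ 6).+1%:R :> R by rewrite sqrtr_gt0.
  rewrite ler_pdivrMr// (le_trans J1)//.
  apply: le_trans (ler_wpM2l Q0 S).
  by rewrite /Q (exprS _ 2) (mulrA (_ / _)) divfK ?gt_eqF.
have goodv D : size D = (l ^ 6)%N -> all good D -> \sum_(d <- D) d ^+ 2 <= (c * l%:R) ^+ 2.
  move=> Dl Dg; apply: (@le_trans _ _ (\sum_(d <- D) v' ^+ 2)).
    rewrite !big_seq; apply: ler_sum => d /(allP Dg) /andP[d1 d2].
    by rewrite lerXn2r// nnegrE; lra.
  rewrite big_const_seq count_predT Dl iter_addr_0 -[_ *+ (l ^ 6)%N]mulr_natl natrX /v'.
  by rewrite le_eqVlt; apply/orP; left; apply/eqP; field; rewrite gt_eqF.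
pose M := seg (logsteps c) (m + p + p) (j - (p + p)).
pose ps := [seq (logsteps c k, logsteps c (p + k)) | k <- iota m.+1 p].
have -> : mean (seg (logsteps c) m j) f x = mean [::] (mean (unzip1 ps) (mean (unzip2 ps) (mean M f))) x.
  rewrite /= /unzip1 /unzip2 -!map_comp /M -!mean_cat.
  have -> : [seq (snd \o (fun k => (logsteps c k, logsteps c (p + k)))) i | i <- iota m.+1 p] =
      seg (logsteps c) (m + p) p.
    by rewrite /seg -addSn addnC iotaDl -map_comp.
  rewrite (_ : map _ _ = seg (logsteps c) m p)// -seg_cat -addnA -seg_cat.
  by congr (mean (seg _ _ _) _ _); lia.
have -> : 72 * Q / Num.sqrt j%:R + 2 ^+ (l ^ 6 + l ^ 6) * (3 / 4) ^+ p =
   72 * Q / Num.sqrt j%:R + 2 ^+ (l ^ 6 + l ^ 6 - size ([::] : seq R)) * (3 / 4) ^+ size ps.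
  by rewrite subn0 size_map size_iota.
apply: (@mean_pairs_le _ good) => //.
- by move=> y; rewrite mean_ge0/= ?mean_le// => z; rewrite ?ler0n ?ind_le1.
- by rewrite divr_ge0 ?sqrtr_ge0// mulr_ge0.
- move=> D Dl Dg y; rewrite meanC -(cat_take_drop (l ^ 6) D).
  have [s1 s2] : size (take (l ^ 6) D) = (l ^ 6)%N /\ size (drop (l ^ 6) D) = (l ^ 6)%N.
    by rewrite size_takel ?size_drop Dl ?addnK ?leq_addr.
  have [g1 g2] : all good (take (l ^ 6) D) /\ all good (drop (l ^ 6) D).
    by apply/andP; rewrite -all_cat cat_take_drop.
  have Ma : all (fun b => c * l%:R <= 2 * b) M.
    by apply: seg_all => i hi; apply: logsteps_ge => //; rewrite lN; clear -Nm hi; lia.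
  have := @two_scale _ _ _ _ C Q (c * l%:R) y ltac:(nra) ltac:(lra)
    (fun z => goodQ _ z s1 g1) (fun z => goodQ _ z s2 g2) (goodv _ s1 g1) (goodv _ s2 g2) Ma.
  move=> h; apply: le_trans h _; rewrite size_seg.
  have j0 : 0 < Num.sqrt j%:R :> R by rewrite sqrtr_gt0 ltr0n; clear -pj p0; lia.
  have hj : Num.sqrt j%:R <= 2 * Num.sqrt (j - (p + p)).+1%:R :> R.
    rewrite -(@ler_pXn2r _ 2) ?nnegrE ?mulr_ge0 ?sqrtr_ge0// exprMn !sqr_sqrtr//.
    by rewrite -natrX -natrM ler_nat; clear -pj p0; lia.
  rewrite ler_pdivrMr ?sqrtr_gt0 ?ltr0n// mulrAC ler_pdivlMr//.
  have := ler_wpM2l Q0 hj; lra.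
- rewrite all_map; apply/allP => k; rewrite mem_iota => hk /=.
  have k0 : (0 < k)%N by lia.
  have /andP[h1 h2] := @logsteps_diff c k p c0 k0.
  have p0' : 0 < p%:R :> R by rewrite ltr0n.
  have NR : N%:R = p%:R * l%:R ^+ 2 :> R by rewrite -pN natrM natrX.
  have l2 : 0 < l%:R ^+ 2 :> R by rewrite exprn_gt0.
  apply/andP; split; [apply: le_trans h1|apply: le_trans h2 _].
    have pk : (p + k)%:R <= 8 * (p%:R * l%:R ^+ 2) :> R.
      by rewrite -NR -natrM ler_nat; clear -hk mN pj p0; lia.
    rewrite /v ler_pM2l// -[leLHS]div1r ler_pdivlMr ?ltr0n ?addn_gt0 ?p0//.
    by rewrite mulrAC ler_pdivrMr ?mulr_gt0//; lra.
  have pk : p%:R * l%:R ^+ 2 <= k%:R :> R by rewrite -NR ler_nat; clear -hk Nm; lia.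
  by rewrite /v' ler_pM2l// ler_pdivrMr ?ltr0n// mulrC ler_pdivlMr.
Qed.

End LogWalk.

(** * A uniform chance of returning to the origin *)

Section LogHit.
Context {R : realType}.
Implicit Types (c C : R).

Lemma ler_sum_widen m n (F : nat -> R) : (m <= n)%N -> (forall i, 0 <= F i) ->
  \sum_(i < m) F i <= \sum_(i < n) F i.
Proof.
move=> mn F0; rewrite (big_ord_widen n F mn) big_mkcond /=.
by apply: ler_sum => i _; case: ifP.
Qed.

Lemma sum_odd_le (F : nat -> R) n : (forall i, 0 <= F i) ->
  \sum_(t < n) F (2 * t).+1 <= \sum_(i < 2 * n) F i.
Proof.
move=> F0; elim: n => [|n IHn]; first by rewrite !big_ord0.
by rewrite mulnS add2n !big_ord_recr/= lerD// (le_trans IHn)// lerDl.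
Qed.

Lemma sum_half_le (F : nat -> R) n : (forall i, 0 <= F i) ->
  \sum_(t < n) F (n + t)%N <= \sum_(i < n + n) F i.
Proof.
by move=> F0; rewrite big_split_ord/= lerDr sumr_ge0.
Qed.

Lemma sum_invsq_skip (n i : nat) : (0 < n)%N ->
  \sum_(t < i) ((n + 2 * t).+1%:R ^+ 2)^-1 <= n%:R^-1 :> R.
Proof.
move=> n0; suff H : \sum_(t < i) ((n + 2 * t).+1%:R ^+ 2)^-1 <= n%:R^-1 - (n + i)%:R^-1 :> R.
  by apply: le_trans H _; rewrite gerBl.
elim: i => [|i IHi]; first by rewrite big_ord0 addn0 subrr.
rewrite big_ord_recr/= (le_trans (lerD IHi (lexx _)))// -addrA lerD2l addnS -(@natr1 R (n + i)).
have y0 : 0 < (n + i)%:R :> R by rewrite ltr0n addn_gt0 n0.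
have yz : (n + i)%:R + 1 <= (n + 2 * i).+1%:R :> R by rewrite natr1 ler_nat; lia.
move: y0 yz; move: (_%:R : R) ((n + 2 * i).+1%:R : R) => y z y0 yz.
apply: (@le_trans _ _ (- y^-1 + ((y + 1) ^+ 2)^-1)).
  have [y1 z1] : 0 < y + 1 /\ 0 < z by split; lra.
  by rewrite lerD2l lef_pV2 ?posrE ?exprn_gt0// ler_pXn2r ?nnegrE ?(ltW y1) ?(ltW z1).
rewrite -subr_ge0.
have -> : - (y + 1)^-1 - (- y^-1 + ((y + 1) ^+ 2)^-1) = (y * (y + 1) ^+ 2)^-1.
  by field; apply/andP; split; lra.
by rewrite invr_ge0 mulr_ge0 ?exprn_ge0//; lra.
Qed.

(** Steps that follow each other at time [k] differ by at most [c / k], so the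
    squares of the differences have a small sum once [n] is large. The steps
    themselves are at most [2 * c * l], which dictates [B]. *)
Lemma even_return c C l N n i : 0 < c -> 0 < C -> (3 <= l)%N -> (2 ^ l = N)%N ->
  (0 < n <= N)%N -> 16 * c ^+ 2 <= C ^+ 2 * n%:R -> (i <= 2 * N)%N ->
  (4 * (48 * c / C + 1) * (l%:R * Num.sqrt N%:R))^-1 <=
    mean (seg (logsteps c) n (2 * i)) (fun y => ind (`|y| <= C) : R) 0.
Proof.
move=> c0 C0 l3 lN /andP[n0 nN] cn iN.
have N1 : 1 <= N%:R :> R by rewrite ler1n; lia.
have l1 : 1 <= l%:R :> R by rewrite ler1n; lia.
have s1 : 1 <= Num.sqrt N%:R :> R by rewrite -[leLHS]sqrtr1 ler_sqrt; lra.
have s2 : Num.sqrt N%:R ^+ 2 = N%:R :> R by rewrite sqr_sqrtr ?ler0n.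
set s := Num.sqrt N%:R in s1 s2 *.
have ls1 : 1 <= l%:R * s by nra.
pose b := logsteps c.
pose ps := [seq (b (n + 2 * t).+1, b (n + 2 * t).+2 - b (n + 2 * t).+1) | t <- iota 0 i].
rewrite mean_interleave -/b.
have -> : [seq b (n + 2 * t).+1 | t <- iota 0 i] = [seq p.1 | p <- ps] by rewrite -map_comp.
have -> : [seq b (n + 2 * t).+2 | t <- iota 0 i] = [seq p.1 + p.2 | p <- ps].
  by rewrite -map_comp; apply: eq_map => t /=; rewrite addrC subrK.
pose B := 12 * c * (l%:R * s); pose J := (Num.truncn (4 * B / C)).+1.
have B0 : 0 < B by rewrite /B !mulr_gt0//; lra.
have h : 4 * J%:R <= 4 * (48 * c / C + 1) * (l%:R * s).
  have : J%:R <= 48 * c / C * (l%:R * s) + 1.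
    rewrite /J -[leLHS]natr1 lerD2r -[leRHS](_ : 4 * B / C = _); last by rewrite /B; field; rewrite gt_eqF.
    by rewrite truncn_le; apply: divr_ge0; lra.
  by lra.
have J0 : 0 < J%:R :> R by rewrite ltr0n.
apply: (@le_trans _ _ (4 * J%:R)^-1).
  have J4 : 0 < 4 * J%:R :> R by lra.
  by rewrite lef_pV2// posrE (lt_le_trans J4 h).
apply: (@pair_return _ ps C B J) => //.
- by have := truncnS_gt (4 * B / C); rewrite -/J ltr_pdivrMr// => /ltW.
- rewrite big_map; apply: (@le_trans _ _ (4 * \sum_(t <- iota 0 i) (2 * c * l%:R) ^+ 2)).
    rewrite ler_pM2l// !big_seq; apply: ler_sum => t; rewrite mem_iota add0n => /andP[_ ti] /=.
    have : b (n + 2 * t).+1 <= c * (l + 3)%:R.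
      by apply: logsteps_le => //; rewrite expnD lN; clear -ti iN nN; lia.
    have : 0 <= b (n + 2 * t).+1 by rewrite /b /logsteps mulr_ge0 ?ln_ge0 ?ler1n// ltW.
    have l3' : 3 <= l%:R :> R by rewrite (ler_nat R 3).
    move=> h1 h2; rewrite lerXn2r ?nnegrE//; first by rewrite !mulr_ge0// ltW.
    by apply: le_trans h2 _; rewrite natrD; nra.
  rewrite big_const_seq count_predT size_iota iter_addr_0 -[_ *+ i]mulr_natl.
  have iN' : i%:R <= 2 * N%:R :> R by rewrite -natrM ler_nat.
  rewrite /B !exprMn s2; have : 0 < c ^+ 2 * l%:R ^+ 2 by rewrite mulr_gt0// exprn_gt0//; lra.
  move: (c ^+ 2) (l%:R ^+ 2) => u v uv.
  have := ler_wpM2l (ltW uv) iN'; have : 0 <= u * v * N%:R by rewrite mulr_ge0// ltW.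
  lra.
- rewrite big_map -[iota 0 i](_ : index_iota 0 i = _); last by rewrite /index_iota subn0.
  rewrite big_mkord; apply: (@le_trans _ _ (16 * (c ^+ 2 * n%:R^-1))).
    rewrite ler_pM2l//; apply: le_trans (ler_wpM2l (sqr_ge0 c) (sum_invsq_skip i n0)).
    rewrite mulr_sumr; apply: ler_sum => t _ /=.
    have /andP[] := @logsteps_diff R c (n + 2 * t).+1 1 c0 isT; rewrite add1n -/b => h1 h2.
    rewrite -exprVn -exprMn -[(n + 2 * t).+1%:R^-1]mul1r lerXn2r// nnegrE.
      by apply: le_trans h1; rewrite !mulr_ge0// ltW.
    by rewrite !mulr_ge0// ltW.
  by rewrite mulrA ler_pdivrMr ?ltr0n.
Qed.

Lemma pow_dominates e : (6 <= e)%N -> (8 * e + 4 <= 2 ^ e)%N.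
Proof.
elim: e => // e IHe; rewrite leq_eqVlt => /predU1P[<-//|e6].
by have := IHe e6; rewrite expnS; lia.
Qed.

(** With powers of two for [l], [N] and [p] alike, the Chernoff error of
    [fine_return] is compared with the other terms through exponents. *)
Lemma error_small e (l := (2 ^ e)%N) (p := (2 ^ (l - 2 * e))%N) : (6 <= e)%N ->
  (8 * 2 ^ l)%:R * l%:R * (2 ^+ (l ^ 6 + l ^ 6) * (3 / 4) ^+ p) <= 1 :> R.
Proof.
move=> e6; have el := pow_dominates e6; rewrite -/l in el.
pose M := (3 + l + e + (l ^ 6 + l ^ 6))%N.
have Mp : (M * 3 <= p)%N.
  have l6 : (l ^ 6 = 2 ^ (6 * e))%N by rewrite -expnM mulnC.
  have : (2 ^ (4 + 6 * e) <= p)%N by rewrite leq_exp2l//; clear -el; lia.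
  rewrite expnD -l6; have : (l <= l ^ 6)%N by rewrite -{1}(expn1 l) leq_exp2l//; clear -el e6; lia.
  by rewrite /M; clear -el e6; move: (l ^ 6)%N p => x y; lia.
have -> : (8 * 2 ^ l)%:R * l%:R * (2 ^+ (l ^ 6 + l ^ 6) * (3 / 4) ^+ p) =
    2 ^+ M * (3 / 4) ^+ p :> R.
  rewrite /M !exprD natrM !natrX /l; ring.
apply: (@le_trans _ _ (2 ^+ M * (3 / 4) ^+ (M * 3))).
  rewrite ler_wpM2l ?exprn_ge0// ler_wiXn2l//; lra.
rewrite mulnC exprM -exprMn exprn_ile1//; lra.
Qed.

(** Only the even numbers of steps between [2 * N] and [4 * N] are counted. *)
Lemma log_visits_ge c C l N n : 0 < c -> 0 < C -> (3 <= l)%N -> (2 ^ l = N)%N ->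
  (0 < n <= N)%N -> 16 * c ^+ 2 <= C ^+ 2 * n%:R ->
  Num.sqrt N%:R / (4 * (48 * c / C + 1) * l%:R) <=
    visits (logsteps c) C N (8 * N - n) n 0.
Proof.
move=> c0 C0 l3 lN nN cn; rewrite visits_sum.
have N0 : (0 < N)%N by case/andP: nN => n0 /(leq_trans n0).
pose f := fun y : R => ind (`|y| <= C) : R; rewrite -/f.
pose F (i : nat) : R := (N < n + i.+1)%N%:R * mean (seg (logsteps c) n i.+1) f 0.
have F0 i : 0 <= F i by rewrite mulr_ge0 ?mean_ge0// => y; rewrite ler0n.
apply: (@le_trans _ _ (\sum_(t < N) F (2 * (N + t)).+1)); last first.
  apply: le_trans (sum_half_le (F := fun t => F (2 * t).+1) _ _) _; first by [].
  apply: le_trans (sum_odd_le _ _) _; first by [].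
  by apply: ler_sum_widen => //; clear -nN; lia.
set X := _ / _; have -> : X = \sum_(t < N) (4 * (48 * c / C + 1) * (l%:R * Num.sqrt N%:R))^-1.
  rewrite sumr_const card_ord -[_ *+ N]mulr_natl.
  have s2 : N%:R = Num.sqrt N%:R ^+ 2 :> R by rewrite sqr_sqrtr ?ler0n.
  have s0 : 0 < Num.sqrt N%:R :> R by rewrite sqrtr_gt0 ltr0n.
  have l0 : 0 < l%:R :> R by rewrite ltr0n; clear -l3; lia.
  have k0 : 0 < 48 * c / C + 1 by rewrite addr_gt0// divr_gt0// mulr_gt0.
  rewrite [in RHS]s2 /X sqr_sqrtr ?ler0n// {2}s2.
  by move: (48 * c / C + 1) (Num.sqrt _) k0 s0 => u s u0 s0; field; rewrite !gt_eqF.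
apply: ler_sum => t _; rewrite /F.
have -> : (N < n + (2 * (N + t)).+2)%N by clear; lia.
rewrite mul1r (_ : (2 * (N + t)).+2 = 2 * (N + t).+1)%N; last by clear; lia.
by apply: even_return => //; have := ltn_ord t; clear; lia.
Qed.

(** By the coarse bound the first [4 * p] steps contribute at most a multiple of
    [sqrt p], which is [sqrt N / l]; the gain of [fine_return] takes care of all
    the later ones. *)
Lemma log_visits_le c C e (l := (2 ^ e)%N) (N := (2 ^ l)%N) m j y :
  0 < c -> 0 < C -> (6 <= e)%N -> 2 * C < c * l%:R ->
  (N < m)%N -> (m + j = 8 * N)%N ->
  1 + visits (logsteps c) C N j m y <= (6 + 432 * (8 * C / c + 1)) * (Num.sqrt N%:R / l%:R).
Proof.
move=> c0 C0 e6 Cl Nm mj; have el := pow_dominates e6; rewrite -/l in el.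
pose p := (2 ^ (l - 2 * e))%N; pose f := fun y : R => ind (`|y| <= C) : R.
have p0 : (0 < p)%N by rewrite expn_gt0.
have pN : (p * l ^ 2 = N)%N by rewrite /l -expnM -expnD /N mulnC; congr expn; clear -el; lia.
have l0 : (0 < l)%N by clear -el; lia.
have l1 : 1 <= l%:R :> R by rewrite ler1n.
set s := Num.sqrt N%:R; set K := 8 * C / c + 1.
have sE : s = Num.sqrt p%:R * l%:R.
  by rewrite /s -pN natrM natrX sqrtrM// sqrtr_sqr ger0_norm.
have q1 : 1 <= Num.sqrt p%:R :> R by rewrite -[leLHS]sqrtr1 ler_sqrt ?ler1n// ltr0n.
have K0 : 0 <= K by rewrite addr_ge0// divr_ge0 ?mulr_ge0// ltW.
pose err : R := 2 ^+ (l ^ 6 + l ^ 6) * (3 / 4) ^+ p.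
have err0 : 0 <= err by rewrite mulr_ge0 ?exprn_ge0//; lra.
have herr : (8 * N)%:R * err <= 1.
  have := @error_small e e6; rewrite -/l -/N -/p -/err.
  by apply: le_trans; rewrite [leRHS]mulrAC ler_peMr// mulr_ge0 ?ler0n.
pose g (i : nat) : R := (Num.sqrt i.+1%:R)^-1.
have g0 i : 0 <= g i by rewrite invr_ge0 sqrtr_ge0.
pose F (i : nat) : R := (i < 4 * p)%N%:R * g i + (72 * (K / l%:R) * g i + err).
have F0 i : 0 <= F i.
  by rewrite addr_ge0 ?mulr_ge0// addr_ge0// !mulr_ge0// invr_ge0 ler0n.
have term (i : 'I_j) : (N < m + i.+1)%N%:R * mean (seg (logsteps c) m i.+1) f y <= F i.
  have ij := ltn_ord i; have -> : (N < m + i.+1)%N by apply: leq_trans Nm (leq_addr _ _).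
  rewrite mul1r /F; case: ltnP => ip; last first.
    have h1 : (N <= m)%N by exact: ltnW.
    have h2 : (m + i.+1 <= 8 * N)%N by rewrite -mj leq_add2l.
    have h3 : (4 * p <= i.+1)%N by exact: leqW.
    by rewrite mul0r add0r; exact: (fine_return _ c0 C0 Cl p0 pN erefl h1 h2 h3).
  rewrite mul1r; apply: (@le_trans _ _ (g i)); last first.
    by rewrite lerDl addr_ge0// !mulr_ge0// invr_ge0 ler0n.
  apply: (@le_trans _ _ (Num.sqrt i.+2%:R)^-1).
    apply: coarse_return Cl _ _; first by rewrite mulr_gt0// ltr0n.
    by move=> k /andP[mk _]; apply: logsteps_ge => //; rewrite -/N; clear -Nm mk; lia.
  by rewrite lef_pV2 ?posrE ?sqrtr_gt0 ?ltr0n// ler_sqrt ?ltr0n// ler_nat.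
rewrite visits_sum -/f; apply: (@le_trans _ _ (1 + \sum_(i < 8 * N) F i)).
  rewrite lerD2l; apply: le_trans (ler_sum_widen (n := (8 * N)%N) _ F0); first exact: ler_sum.
  by rewrite -mj leq_addl.
rewrite big_split big_split/= -mulr_sumr sumr_const card_ord -[err *+ _]mulr_natl.
have p4 : (4 * p <= 8 * N)%N by rewrite -pN; clear -l0 ; nia.
have h1 : \sum_(i < 8 * N) (i < 4 * p)%N%:R * g i <= 4 * Num.sqrt p%:R.
  apply: (@le_trans _ _ (\sum_(i < 4 * p) g i)).
    rewrite (big_ord_widen _ g p4) [leRHS]big_mkcond/=; apply: ler_sum => i _.
    by case: ifP; rewrite ?mul1r ?mul0r.
  apply: le_trans (sum_invsqrt _) _; rewrite natrM sqrtrM ?ler0n//.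
  have -> : Num.sqrt 4%:R = 2 :> R.
    by rewrite (_ : 4%:R = 2 ^+ 2) ?sqrtr_sqr ?ger0_norm// -natrX.
  lra.
have h2 : \sum_(i < 8 * N) g i <= 6 * s.
  apply: le_trans (sum_invsqrt _) _; rewrite natrM sqrtrM ?ler0n// -/s.
  have : Num.sqrt 8%:R <= 3 :> R.
    by rewrite -(@ger0_norm R 3)// -sqrtr_sqr ler_sqrt; lra.
  have : 0 <= s by rewrite sqrtr_ge0.
  nra.
have kl0 : 0 <= 72 * (K / l%:R) by rewrite !mulr_ge0// invr_ge0 ler0n.
have := ler_wpM2l kl0 h2; rewrite sE mulfK ?gt_eqF//; last by rewrite ltr0n.
have -> : 72 * (K / l%:R) * (6 * (Num.sqrt p%:R * l%:R)) = 432 * K * Num.sqrt p%:R.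
  by field; rewrite gt_eqF// ltr0n.
by move: q1 h1 herr; lra.
Qed.

(** Between the times [N] and [8 * N], the lower bound on the expected number of
    visits and the upper bound on the expected number of visits that follow a
    given one are both multiples of [sqrt N / l], so their quotient, which
    bounds the chance of a visit from below, does not depend on [N]. *)
Theorem log_hit c C : 0 < c -> 0 < C -> exists q n1, 0 < q /\
  forall n N0, (n1 <= n)%N -> exists N j, (N0 <= N)%N /\
    avoid (logsteps c) C N j n 0 <= 1 - q.
Proof.
move=> c0 C0.
pose K1 := 6 + 432 * (8 * C / c + 1); pose K2 := 4 * (48 * c / C + 1).
have K10 : 0 < K1 by have : 0 < 8 * C / c; [rewrite divr_gt0 ?mulr_gt0|rewrite /K1; lra].
have K20 : 0 < K2 by have : 0 < 48 * c / C; [rewrite divr_gt0 ?mulr_gt0|rewrite /K2; lra].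
exists (K1 * K2)^-1, (Num.truncn (16 * c ^+ 2 / C ^+ 2)).+1.
split=> [|n N0 n1]; first by rewrite invr_gt0 mulr_gt0.
have [e [e6 ne N0e te]] : exists e, [/\ (6 <= e)%N, (n <= e)%N, (N0 <= e)%N &
    (Num.truncn (2 * C / c) <= e)%N].
  by exists (6 + n + N0 + Num.truncn (2 * C / c))%N; split; lia.
pose l := (2 ^ e)%N; pose N := (2 ^ l)%N.
have el : (e < l)%N by exact: ltn_expl.
have lN : (l < N)%N by exact: ltn_expl.
have n0 : (0 < n)%N by apply: leq_trans n1.
have cn : 16 * c ^+ 2 <= C ^+ 2 * n%:R.
  have := truncnS_gt (16 * c ^+ 2 / C ^+ 2).
  rewrite ltr_pdivrMr ?exprn_gt0// => /ltW h; apply: le_trans h _.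
  by rewrite mulrC ler_pM2l ?exprn_gt0// ler_nat.
have Cl : 2 * C < c * l%:R.
  have := truncnS_gt (2 * C / c); rewrite ltr_pdivrMr// => h; apply: lt_le_trans h _.
  by rewrite mulrC ler_pM2l// ler_nat (leq_ltn_trans te el).
have eN := ltnW (ltn_trans el lN).
have nN : (n <= N)%N := leq_trans ne eN.
exists N, (8 * N - n)%N; split; first exact: leq_trans eN.
have l0 : 0 < l%:R :> R by rewrite ltr0n (leq_ltn_trans _ el).
have s0 : 0 < Num.sqrt N%:R :> R by rewrite sqrtr_gt0 ltr0n expn_gt0.
have low : Num.sqrt N%:R / (K2 * l%:R) <= visits (logsteps c) C N (8 * N - n) n 0.
  have l3 : (3 <= l)%N by apply: leq_trans (ltnW el); apply: leq_trans e6.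
  by apply: log_visits_ge => //; rewrite n0.
have up : visits (logsteps c) C N (8 * N - n) n 0 <=
    K1 * (Num.sqrt N%:R / l%:R) * (1 - avoid (logsteps c) C N (8 * N - n) n 0).
  apply: visits_avoid => j' k' y Nk kj _; apply: log_visits_le => //.
  by rewrite kj subnKC//; clear -nN; lia.
have h := le_trans low up; rewrite lerBrDr -lerBrDl.
have S0 : 0 < K1 * (Num.sqrt N%:R / l%:R) by rewrite mulr_gt0// divr_gt0.
rewrite -(ler_pM2l S0); apply: le_trans h; rewrite le_eqVlt; apply/orP; left; apply/eqP.
by field; rewrite !gt_eqF.
Qed.

End LogHit.

Section Vanish.
Context {R : realType}.

Lemma log_avoid_vanishes (c C : R) N eps : 0 < c -> 0 < C -> 0 < eps ->
  exists j, avoid (logsteps c) C N j 0 0 <= eps.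
Proof.
move=> c0 C0 e0; have C2 : 0 < C / 2 by rewrite divr_gt0.
have [q [n1 [q0 hit]]] := log_hit c0 C2.
pose n2 := (maxn n1 (Num.truncn (2 * c / (C / 2))).+1)%N.
have unb M n : exists2 k, (n <= k)%N & M < logsteps c k.
  pose l := (n + (Num.truncn (2 * M / c)).+1)%N; exists (2 ^ l)%N.
    by apply: leq_trans (ltnW (ltn_expl l _)); rewrite ?leq_addr.
  have := @logsteps_ge _ c l (2 ^ l) c0 (leqnn _).
  have : 2 * M < c * l%:R.
    have := truncnS_gt (2 * M / c); rewrite ltr_pdivrMr// [ltRHS]mulrC => h.
    by apply: lt_le_trans h _; rewrite ler_pM2l// ler_nat leq_addl.
  lra.
have slow k : (n2 <= k)%N -> 2 * (logsteps c k.+1 - logsteps c k) <= C / 2.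
  rewrite geq_max => /andP[_ nk]; have k0 : (0 < k)%N by apply: leq_trans nk.
  have /andP[_] := @logsteps_diff _ c k 1 c0 k0; rewrite add1n => h.
  have : 2 * c / k%:R <= C / 2.
    have := truncnS_gt (2 * c / (C / 2)); rewrite ltr_pdivrMr// => h1.
    rewrite ler_pdivrMr ?ltr0n// [leRHS]mulrC; apply: le_trans (ltW h1) _.
    by rewrite ler_pM2r// ler_nat.
  by move: h; rewrite mul1r -mulrA; lra.
have hit' k N0 : (n2 <= k)%N -> exists N' j, (N0 <= N')%N /\
    avoid (logsteps c) (C / 2) N' j k 0 <= 1 - q.
  by rewrite geq_max => /andP[n1k _]; exact: hit.
by rewrite (splitr C); exact: (avoid_vanishes N C2 unb slow q0 hit').
Qed.

End Vanish.

(** * From averages to the probability space *)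

Section Bridge.
Context d (T : measurableType d) (R : realType) (P : probability T R).
Context (X : nat -> {RV P >-> R}) (a : nat -> R) (C : R) (N : nat).
Context (X_signs : iid_signs X).

Let miss k j : set T :=
  \bigcap_(m in [set m | (k < m <= k + j)%N && (N < m)%N]) [set w | C < `|walk a X m w|].

Let cylinder (s : nat -> R) k : set T :=
  \bigcap_(i in [set` iota 1 k]) X i @^-1` [set s i].

Let position (s : nat -> R) k : R := \sum_(1 <= i < k.+1) a i * s i.

Lemma measurable_far m : measurable [set w | C < `|walk a X m w|].
Proof.
have mf : measurable_fun setT (fun w => `|walk a X m w|).
  apply: measurableT_comp => //; apply: measurable_sum => i.
  exact: measurable_funM.
rewrite -[X in measurable X]setTI.
rewrite (_ : [set w | _] = (fun w => `|walk a X m w|) @^-1` `]C, +oo[%classic).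
  exact: mf.
by apply/seteqP; split=> w /=; rewrite in_itv/= andbT.
Qed.

Lemma measurable_miss k j : measurable (miss k j).
Proof. by apply: bigcap_measurableType => m _; exact: measurable_far. Qed.

Lemma measurable_cylinder s k : measurable (cylinder s k).
Proof.
apply: bigcap_measurableType => i _.
by rewrite -[X in measurable X]setTI; apply: (measurable_funP (X i)).
Qed.

Lemma prob_cylinder s k : (forall i, s i = 1 \/ s i = -1) ->
  P (cylinder s k) = ((2^-1) ^+ k)%:E.
Proof.
move=> s1; have [indep law] := X_signs.
rewrite /cylinder (indep (iota 1 k) (fun i => [set s i])) ?iota_uniq//; first last.
- by move=> i /=; rewrite mem_iota => /andP[].
rewrite (eq_big_seq (fun=> (2^-1)%:E)); last first.
  move=> i; rewrite mem_iota => /andP[i0 _].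
  by have [p1 p2] := law i i0; case: (s1 i) => ->.
elim: k => [|k IHk]; first by rewrite big_nil expr0.
by rewrite -(addn1 k) iotaD big_cat/= IHk big_seq1 -EFinM exprD.
Qed.

Lemma prob_neither k : (0 < k)%N ->
  P (~` (X k @^-1` [set 1] `|` X k @^-1` [set -1])) = 0%E.
Proof.
move=> k0; have [_ law] := X_signs; have [p1 p2] := law k k0.
have mX y : measurable (X k @^-1` [set y]).
  by rewrite -[X in measurable X]setTI; apply: (measurable_funP (X k)).
rewrite probability_setC; last exact: measurableU.
have disj : X k @^-1` [set 1] `&` X k @^-1` [set -1] = set0.
  apply/seteqP; split=> w //= -[-> w1].
  by have : (1 : R) = -1 := w1; lra.
rewrite measureU//= p1 p2 -EFinD (_ : 2^-1 + 2^-1 = 1 :> R) ?subrr//.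
lra.
Qed.

(** The probability space enters only here, through the cylinders that fix the
    first signs: each of them splits into two halves and a null set. *)
Lemma prob_miss_cylinder j k s : (forall i, s i = 1 \/ s i = -1) ->
  (P (cylinder s k `&` miss k j) <=
     ((2^-1) ^+ k * avoid a C N j k (position s k))%:E)%E.
Proof.
elim: j k s => [|j IHj] k s s1.
  rewrite mulr1 -(prob_cylinder k s1); apply: le_measure; rewrite ?inE//.
  - by apply: measurableI; [exact: measurable_cylinder|exact: measurable_miss].
  - exact: measurable_cylinder.
pose ext (e : R) i := if i == k.+1 then e else s i.
pose B (e : R) := cylinder (ext e) k.+1 `&` miss k j.+1.
have ext1 e : e = 1 \/ e = -1 -> forall i, ext e i = 1 \/ ext e i = -1.
  by move=> he i; rewrite /ext; case: ifP.
have pos e : position (ext e) k.+1 = position s k + a k.+1 * e.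
  rewrite /position big_nat_recr//=; congr (_ + _); last by rewrite /ext eqxx.
  apply: eq_big_nat => i /andP[_ ik]; rewrite /ext ifF//; apply/negP => /eqP E.
  by rewrite E ltnn in ik.
have mB e : measurable (B e).
  by apply: measurableI; [exact: measurable_cylinder|exact: measurable_miss].
pose y e := position s k + a k.+1 * e.
have PB e : e = 1 \/ e = -1 ->
  (P (B e) <= ((2^-1) ^+ k.+1 * (if (N < k.+1)%N && (`|y e| <= C) then 0
                                  else avoid a C N j k.+1 (y e)))%:E)%E.
  move=> he; case: ifP => [/andP[Nk yC]|_].
    rewrite mulr0 (_ : B e = set0) ?measure0//.
    apply/seteqP; split=> w //= -[cw mw].
    have := mw k.+1; rewrite /= Nk andbT ltnS leqnn addnS ltnS leq_addr => /(_ isT).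
    suff -> : walk a X k.+1 w = y e by rewrite ltNge yC.
    rewrite -[y e]pos; apply: eq_big_nat => i /andP[i0 ik]; congr (_ * _).
    by apply: cw; rewrite /mkset mem_iota i0 add1n.
  rewrite -[y e]pos; apply: le_trans (IHj k.+1 _ (ext1 _ he)).
  apply: le_measure; rewrite ?inE//.
    by apply: measurableI; [exact: measurable_cylinder|exact: measurable_miss].
  apply: setIS => w mw m /= hm; apply: mw; move: hm => /=; rewrite addSnnS; lia.
pose Z : set T := ~` (X k.+1 @^-1` [set 1] `|` X k.+1 @^-1` [set -1]).
have mZ : measurable Z.
  have mX z : measurable (X k.+1 @^-1` [set z]).
    by rewrite -[X in measurable X]setTI; apply: (measurable_funP (X k.+1)).
  by apply: measurableC; exact: measurableU.
apply: (@le_trans _ _ (P (B 1 `|` B (-1) `|` Z))).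
  apply: le_measure; rewrite ?inE//.
  - by apply: measurableI; [exact: measurable_cylinder|exact: measurable_miss].
  - by apply: measurableU => //; exact: measurableU.
  move=> w [cw mw].
  have cyl e : X k.+1 w = e -> cylinder (ext e) k.+1 w.
    move=> we i; rewrite /mkset mem_iota => hi; rewrite /preimage /mkset /ext; case: eqP => [->//|ne].
    by apply: cw; rewrite /mkset mem_iota; lia.
  have [w1|w1] := pselect (X k.+1 w = 1); first by left; left; split => //; exact: cyl.
  have [w2|w2] := pselect (X k.+1 w = -1); first by left; right; split => //; exact: cyl.
  by right; move=> -[].
apply: (@le_trans _ _ (P (B 1%R `|` B (-1)%R) + P Z)%E).
  by apply: measureU2 => //; exact: measurableU.
have -> : P Z = 0%E by exact: prob_neither.
rewrite adde0; apply: (@le_trans _ _ (P (B 1%R) + P (B (-1)%R))%E); first exact: measureU2.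
apply: le_trans (leeD (PB 1 (or_introl erefl)) (PB (-1) (or_intror erefl))) _.
rewrite -EFinD lee_fin /= /step /y mulr1 mulrN1 exprS.
by move: (if _ then _ else _) (if _ then _ else _) (2^-1 ^+ k) => u v z; lra.
Qed.

Lemma prob_miss j : (P (miss 0 j) <= (avoid a C N j 0 0)%:E)%E.
Proof.
have := @prob_miss_cylinder j 0 (fun=> 1) (fun=> or_introl erefl).
rewrite expr0 mul1r /position big_geq// (_ : cylinder _ 0 = setT) ?setTI//.
by apply/seteqP; split=> w // _ i.
Qed.

End Bridge.

Unset Implicit Arguments.

Theorem theorem6 (d : measure_display) (T : measurableType d) (R : realType)
    (P : probability T R) (X : nat -> {RV P >-> R}) (c : R) :
  iid_signs X -> 0 < c ->
  forall C : R, 0 < C ->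
    {ae P, forall w, C_recurrent C (fun n => walk (fun k => c * ln k%:R) X n w)}.
Proof.
move=> X_signs c0 C C0.
pose E N := \bigcap_(m in [set m | (N < m)%N]) [set w | C < `|walk (logsteps c) X m w|].
have mE N : measurable (E N).
  by apply: bigcap_measurableType => m _; exact: measurable_far.
have PE N : P (E N) = 0%E.
  apply/eqP; rewrite eq_le measure_ge0 andbT; apply/lee_addgt0Pr => eps e0; rewrite add0e.
  have [j hj] := log_avoid_vanishes N c0 C0 e0.
  apply: le_trans (_ : _ <= (avoid (logsteps c) C N j 0 0)%:E)%E _; last by rewrite lee_fin.
  apply: le_trans (prob_miss _ _ _ X_signs j); apply: le_measure; rewrite ?inE//.
    exact: measurable_miss.
  by move=> w Ew m /andP[_ Nm]; exact: Ew.
apply: (@negligibleS _ _ _ _ (\bigcup_N E N)); last first.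
  by apply: negligible_bigcup => N; exists (E N); split => [||w]; [exact: mE|exact: PE|].
move=> w /= /contrapT /finite_seqP[s sE].
exists (\max_(i <- s) i)%N => // m /= sm; rewrite ltNge; apply/negP => h.
have : [set n | `|walk (logsteps c) X n w| <= C] m by [].
rewrite [X in X m]sE /= => ms.
by have := @leq_bigmax_seq _ s xpredT id m ms isT; rewrite leqNgt sm.
Qed.
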